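(* Let $M>0$ and let $\mathcal B_{local}$ be a convex subset of $\{\check\beta\in\mathcal B:\underline\Omega(\check\beta-\beta_0)\le M\}$. Assume: (A1) $(y_i,X_i)$ are iid across $i=1,\dots,n$; $\max_{1\le j\le p}E|X_{1j}|^{r_x}\le C<\infty$ for some $r_x\ge4$; $0<c\le\Gamma^2(2,S_0)\le C<\infty$. (A2)(i) $\max\big(\sqrt{EM_1^2}\sqrt{\ln p}/\sqrt n,\ \sqrt{EM_2^2}\sqrt{\ln p}/\sqrt n\big)=O(1)$, with $M_1=\max_{i\le n}\max_{j,l\le p}|X_{ij}X_{il}-EX_{ij}X_{il}|$, $M_2=\max_{i\le n}\max_{j\le p}|X_{ij}|$. (A3) There are positive constants $C_\rho,\kappa$ with $\ddot\rho(y_i,X_i'\beta)\ge1/C_\rho^2$ for all $\beta$ with $\sup_{\beta_0\in\mathcal B_{l_0}(s_0)}|X_i'(\beta-\beta_0)|\le\kappa$. Then, with probability at least $1-\frac1{p^{2c}}-\frac{C}{4(\ln p)^2}=1-o(1)$ for some positive constants $c,C$, for all $\tilde\beta\in\mathcal B_{local}$, $$R(\tilde\beta)-R(\beta_0)\ge\frac{\|X(\tilde\beta-\beta_0)\|_n^2}{2C_\rho^2}-\frac{M^2t_1}{2C_\rho^2},$$ where $t_1>0$ is the sequence given in the context, and $t_1=O(\sqrt{\ln p/n})$.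
   Context: Notation. Observations $(y_i,X_i)$, $y_i\in\mathcal Y\subseteq\mathbb R$, $X_i\in\mathbb R^p$, $i\le n$; $X$ is $n\times p$ with rows $X_i'$; $n\to\infty$, $p=p_n\to\infty$. $\|v\|_n^2=v'v/n$. $c,C,K$ are generic positive constants not depending on $n$. Model. $\rho(y_i,X_i'\beta)$ is convex in $\beta\in\mathcal B$ (convex subset of $\mathbb R^p$) and twice differentiable in its second argument, with derivatives $\dot\rho,\ddot\rho$. $R(\beta)=E\rho(y_i,X_i'\beta)$, $\beta_0=\arg\min_{\beta\in\mathcal B}R(\beta)$ (so the gradient of $R$ vanishes at $\beta_0$). Norms. $\beta_S$ ($\beta_{S^c}$) is $\beta$ with entries outside (inside) $S$ set to $0$. $\Omega$ is generated from a convex cone $\mathcal A\subset(0,\infty)^p$: $\Omega(\beta)=\min_{a\in\mathcal A}\frac12\sum_j(\beta_j^2/a_j+a_j)$. $S$ is allowed if there is a norm $\Omega^{S^c}$ on $\mathbb R^{p-|S|}$ with $\Omega(\beta)\ge\Omega(\beta_S)+\Omega^{S^c}(\beta_{S^c})$ for all $\beta$; $\Omega^{S^c}$ is the largest such norm, and $\underline\Omega(\beta)=\Omega(\beta_{S_0})+\Omega^{S_0^c}(\beta_{S_0^c})$. $\|x\|_1\le\underline\Omega(x)$, and the dual norm satisfies $\underline\Omega_*(x)\le\|x\|_\infty$. Sparsity. $S_0$ is the active set: an allowed set carrying the indices of the relevant (nonzero) elements of $\beta_0$; $s_0=|S_0|$; $\mathcal B_{l_0}(s_0)=\{\beta_0:\|\beta_0\|_{l_0}\le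 s_0\}$. $\Gamma^2(L,S)=[\min\{E\|X\beta_S-X\beta_{S^c}\|_n^2:\Omega(\beta_S)=1,\Omega^{S^c}(\beta_{S^c})\le L\}]^{-1}$. Sequence. $t_1=2K\big[\frac{C\sqrt{\ln p^2}}{\sqrt n}+\frac{\sqrt{EM_1^2}\ln p^2}{n}\big]+\frac{\sqrt{\ln p^2}}{\sqrt n}$.
   Formalization: As written (A3) is void, since the supremum over the unbounded l0-ball is infinite, and the claim then fails; here the curvature bound is assumed at every β in B with |X_i'(β−b)| ≤ κ for some s0-sparse b, which amounts to curvature at X_i'β for all β in B. *)

(* Defs.v *)
From HB Require Import structures.
From mathcomp Require Import all_boot all_order all_algebra.
From mathcomp Require Import all_classical all_reals all_analysis.
Import Order.TTheory GRing.Theory Num.Theory.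
Import numFieldNormedType.Exports.

Set Implicit Arguments.
Unset Strict Implicit.
Unset Printing Implicit Defensive.

Local Open Scope classical_set_scope.
Local Open Scope ring_scope.

Section vectors.
Context {R : realType} {p : nat}.
Implicit Types (b x : 'cV[R]_p) (S : {set 'I_p}).

(* b_S: same length as b, entries outside S set to 0 *)
Definition keep S b : 'cV[R]_p := \col_j (if j \in S then b j 0 else 0).

(* the entries of b with index in S, as a vector of length #|S| *)
Definition coords S b : 'cV[R]_#|S| := \col_k b (enum_val k) 0.

Definition l0norm b : nat := #|[set j | b j 0 != 0]|.

Definition l1norm b : R := \sum_j `|b j 0|.

Definition linfnorm b : R := \big[Num.max/0]_j `|b j 0|.

(* squared empirical norm v'v/n *)
Definition empnorm2 b : R := (b^T *m b) 0 0 / p%:R.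

Definition is_norm (N : 'cV[R]_p -> R) : Prop :=
  [/\ forall b x, N (b + x) <= N b + N x,
      forall (a : R) b, N (a *: b) = `|a| * N b
    & forall b, N b = 0 -> b = 0].

Definition dual_norm (N : 'cV[R]_p -> R) x : R :=
  sup [set (x^T *m b) 0 0 | b in [set b | N b <= 1]].

End vectors.

Section structured_norms.
Context {R : realType} {p : nat}.

Definition positive_convex_cone (A : set 'cV[R]_p) : Prop :=
  [/\ A !=set0,
      forall a, A a -> forall j, 0 < a j 0,
      convex_set A
    & forall (t : R) a, 0 < t -> A a -> A (t *: a)].

(* The minimum over the open cone A need not be attained (it never is at
   b = 0 when p > 0), so it is an infimum. *)
Definition cone_norm (A : set 'cV[R]_p) (b : 'cV[R]_p) : R :=
  inf [set 2^-1 * \sum_j (b j 0 ^+ 2 / a j 0 + a j 0) | a in A].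

Variables (Om : 'cV[R]_p -> R) (S : {set 'I_p}).

(* N is a norm on R^(p - |S|) witnessing that S is allowed *)
Definition complement_norm (N : 'cV[R]_#|~: S| -> R) : Prop :=
  is_norm N /\
  forall b, Om (keep S b) + N (coords (~: S) b) <= Om b.

Definition allowed : Prop := exists N, complement_norm N.

Definition largest_complement_norm (N : 'cV[R]_#|~: S| -> R) : Prop :=
  complement_norm N /\
  forall N', complement_norm N' -> forall v, N' v <= N v.

Definition under_norm (N : 'cV[R]_#|~: S| -> R) (b : 'cV[R]_p) : R :=
  Om (keep S b) + N (coords (~: S) b).

End structured_norms.

Section sampling.
Context d (T : measurableType d) {R : realType} (P : probability T R).

(* mutual independence over the full family; subfamilies are obtained by
   taking the remaining sets equal to setT *)
Definition iid d' (T' : measurableType d') n (Z : 'I_n -> {RV P >-> T'}) : Prop :=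
  (forall A : 'I_n -> set T', (forall i, measurable (A i)) ->
     P (\bigcap_(i in [set: 'I_n]) (Z i @^-1` A i)) =
     (\prod_(i < n) P (Z i @^-1` A i))%E) /\
  (forall i k (A : set T'), measurable A ->
     P (Z i @^-1` A) = P (Z k @^-1` A)).

Context {n p : nat}.

(* an observation is the pair (y_i, X_i) *)
Implicit Type Z : 'I_n -> {RV P >-> (R * p.-tuple R)%type}.

Definition yobs Z (i : 'I_n) (w : T) : R := (Z i w).1.

Definition design Z (w : T) : 'M[R]_(n, p) := \matrix_(i, j) tnth (Z i w).2 j.

(* the linear index X_i'b *)
Definition xb Z (i : 'I_n) (w : T) (b : 'cV[R]_p) : R :=
  (design Z w *m b) i 0.

Definition risk (rho : R -> R -> R) Z (i : 'I_n) (b : 'cV[R]_p) : R :=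
  fine 'E_P[fun w => rho (yobs Z i w) (xb Z i w b)].

Definition M1 Z (w : T) : R :=
  \big[Num.max/0]_(i < n) \big[Num.max/0]_(j < p) \big[Num.max/0]_(l < p)
    `|design Z w i j * design Z w i l
      - fine 'E_P[fun v => design Z v i j * design Z v i l]|.

Definition M2 Z (w : T) : R :=
  \big[Num.max/0]_(i < n) \big[Num.max/0]_(j < p) `|design Z w i j|.

Definition second_moment (M : T -> R) : R := fine 'E_P[fun w => M w ^+ 2].

Definition Gamma2 Z (Om : 'cV[R]_p -> R) (S : {set 'I_p})
    (OmSc : 'cV[R]_#|~: S| -> R) (L : R) : R :=
  (inf [set fine 'E_P[fun w => empnorm2
              (design Z w *m keep S b - design Z w *m keep (~: S) b)]
       | b in [set b | Om (keep S b) = 1 /\ OmSc (coords (~: S) b) <= L]])^-1.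

Definition t1 Z (K C : R) : R :=
  let lp2 := ln (p%:R ^+ 2) in
  2 * K * (C * Num.sqrt lp2 / Num.sqrt n%:R
           + Num.sqrt (second_moment (M1 Z)) * lp2 / n%:R)
  + Num.sqrt lp2 / Num.sqrt n%:R.

End sampling.

(* Main.v *)
Require Import Defs.
From HB Require Import structures.
From mathcomp Require Import all_boot all_order all_algebra.
From mathcomp Require Import all_classical all_reals all_analysis.
From mathcomp Require Import measurable_realfun lra ring.
Import Order.TTheory GRing.Theory Num.Theory.
Import numFieldNormedType.Exports.

Set Implicit Arguments.
Unset Strict Implicit.
Unset Printing Implicit Defensive.

Local Open Scope classical_set_scope.
Local Open Scope ring_scope.

(** Since [Gamma2] is positive, S0 is nonempty, so every value of the linear
    index X_i'b is also taken by a one-sparse centre and (A3) bounds rho'' from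
    below along all of B.  Hence t |-> rho(y, X'(beta0 + t (b - beta0))) is
    strongly convex with modulus (X'(b - beta0))^2 / Crho^2; taking expectations,
    using minimality of beta0, dividing by t and letting t tend to 0 gives
    R(b) - R(beta0) >= E(X'(b - beta0))^2 / (2 Crho^2).

    It remains to compare the population Gram matrix with the empirical one: the
    quadratic forms at delta differ by at most |delta|_1^2 times the largest
    entrywise deviation, and |delta|_1 <= M.  With u = ln p, the bound
    E M1^2 <= D n / u, and tau of order sqrt (n / u), split each centred product
    according to whether m_i := max_{j,l} |X_ij X_il - E X_ij X_il| exceeds tau.
    The truncated sums are controlled by Chernoff's bound with parameter of order
    1 / tau and a union bound over the p^2 entries.  For the rest, P(M1 > tau) <=
    1/2 and independence give sum_i E m_i^2 1{m_i > tau} <= 2 E M1^2, so that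
    sum_i m_i 1{m_i > tau} has second moment at most 4 E M1^2 and exceeds
    sqrt (n u) with probability O(1 / u^2). *)

(** * Expectations of independent random variables *)

Section scaled_law.
Local Open Scope ereal_scope.
Context d (T : measurableType d) d' (T' : measurableType d') {R : realType}.
Variables (P : {measure set T -> \bar R}) (X : T -> T') (mX : measurable_fun [set: T] X).
Variables (W : T -> R) (mW : measurable_fun [set: T] W) (W0 : forall w, (0 <= W w)%R).
Variables (c : R) (c0 : (0 <= c)%R).
Hypothesis indic_case : forall A, measurable A ->
  \int[P]_w (W w * \1_A (X w))%:E = c%:E * \int[P]_w (\1_A (X w))%:E.

Import HBNNSimple.

Let mEX (g : T' -> R) : measurable_fun [set: T'] g ->
  measurable_fun [set: T] (fun w => (g (X w))%:E).
Proof. by move=> mg; apply/measurable_EFinP; exact: measurableT_comp. Qed.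

Let mWEX (g : T' -> R) : measurable_fun [set: T'] g ->
  measurable_fun [set: T] (fun w => (W w * g (X w))%:E).
Proof.
by move=> mg; apply/measurable_EFinP; apply: measurable_funM => //; exact: measurableT_comp.
Qed.

(** A simple function is a finite combination of indicators of its level sets, so linearity reduces
    this to [indic_case]. *)
Let scaled_nnsfun (h : {nnsfun T' >-> R}) :
  \int[P]_w (W w * h (X w))%:E = c%:E * \int[P]_w (h (X w))%:E.
Proof.
pose I r : T' -> R := \1_(h @^-1` [set r]).
have mI r : measurable_fun [set: T'] (I r) by exact: measurable_indic.
have mrI r : measurable_fun [set: T'] (fun x => r * I r x)%R.
  exact: measurable_funM.
have ind0 (r : R) (w : T) : (0 <= r * I r (X w))%R.
  by rewrite -lee_fin EFinM nnfun_muleindic_ge0.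
have hE w : h (X w) = (\sum_(r \in range h) (r * I r (X w)))%R.
  by rewrite [in LHS]fimfunE.
have -> : \int[P]_w (h (X w))%:E = \sum_(r \in range h)
    \int[P]_w (r * I r (X w))%:E.
  under eq_integral do rewrite hE -fsumEFin//.
  rewrite ge0_integral_fsum//.
  - by move=> r; exact: (mEX (mrI r)).
  - by move=> r w _; rewrite lee_fin.
rewrite ge0_mule_fsumr; last first.
  by move=> r; apply: integral_ge0 => w _; rewrite lee_fin.
have -> : \int[P]_w (W w * h (X w))%:E =
    \int[P]_w (\sum_(r \in range h) (W w * (r * I r (X w)))%:E).
  apply: eq_integral => w _; rewrite EFinM hE -fsumEFin// ge0_mule_fsumr//.
  by move=> r; rewrite lee_fin.
rewrite ge0_integral_fsum//; last 2 first.
- by move=> r; exact: (mWEX (mrI r)).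
- by move=> r w _; rewrite lee_fin mulr_ge0.
apply: eq_fsbigr => r rh.
have r0 : (0 <= r)%R by move: rh; rewrite inE => -[x _ <-].
under eq_integral do rewrite mulrCA EFinM.
rewrite ge0_integralZl_EFin//; last 2 first.
- by move=> w _; rewrite lee_fin mulr_ge0.
- exact: (mWEX (mI r)).
under [in RHS]eq_integral do rewrite EFinM.
rewrite [in RHS]ge0_integralZl_EFin//; last 2 first.
- by move=> w _; rewrite lee_fin.
- exact: (mEX (mI r)).
by rewrite indic_case// muleCA.
Qed.

(* Applied with W the product of the other factors of a product of functions of
   independent variables. *)
Lemma ge0_integral_scaled_law (f : T' -> R) :
  measurable_fun [set: T'] f -> (forall x, (0 <= f x)%R) ->
  \int[P]_w (W w * f (X w))%:E = c%:E * \int[P]_w (f (X w))%:E.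
Proof.
move=> mf f0.
have mEf : measurable_fun [set: T'] (EFin \o f) by exact/measurable_EFinP.
pose f_ := nnsfun_approx measurableT mEf.
have cvgf w : (f_ n (X w))%:E @[n --> \oo] --> (f (X w))%:E.
  by apply: (cvg_nnsfun_approx measurableT mEf) => //= *; rewrite lee_fin.
have ndf w : nondecreasing_seq (fun n => (f_ n (X w))%:E).
  by move=> a b ab; rewrite lee_fin; exact/lefP/nd_nnsfun_approx.
have mf_ n : measurable_fun [set: T] (fun w => (f_ n (X w))%:E) by exact: mEX.
transitivity (limn (fun n => \int[P]_w (W w * f_ n (X w))%:E)).
  rewrite -monotone_convergence//=.
  - apply: eq_integral => w _; apply/esym/cvg_lim => //.
    under eq_fun do rewrite EFinM.
    by rewrite EFinM; apply: cvgeZl.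
  - by move=> n; exact: mWEX.
  - by move=> n w _; rewrite lee_fin mulr_ge0.
  - move=> w _ a b ab; rewrite lee_fin ler_wpM2l// -lee_fin; exact: ndf.
have -> : \int[P]_w (f (X w))%:E = limn (fun n => \int[P]_w (f_ n (X w))%:E).
  rewrite -monotone_convergence//=.
  - by apply: eq_integral => w _; apply/esym/cvg_lim => //; exact: cvgf.
  - by move=> n w _; rewrite lee_fin.
rewrite -limeMl//.
  by congr (limn _); apply/funext => n /=; rewrite scaled_nnsfun.
apply/ereal_nondecreasing_is_cvgn => a b ab; apply: ge0_le_integral => //.
- by move=> w _; rewrite lee_fin.
- by move=> w _; exact: ndf.
Qed.

End scaled_law.

Section independence.
Context d (T : measurableType d) d' (T' : measurableType d') {R : realType}.
Variables (P : probability T R) (n : nat) (Z : 'I_n -> {RV P >-> T'}).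
Hypothesis indepZ : forall A : 'I_n -> set T', (forall i, measurable (A i)) ->
     P (\bigcap_(i in [set: 'I_n]) (Z i @^-1` A i)) =
     (\prod_(i < n) P (Z i @^-1` A i))%E.

Let mFZ (g : T' -> R) i : measurable_fun [set: T'] g ->
  measurable_fun [set: T] (fun w => g (Z i w)).
Proof. by move=> mg; exact: measurableT_comp. Qed.

(** Independence is given for events only. Indicators are replaced by general functions one index at
    a time, by [ge0_integral_scaled_law]; finiteness of the integrals makes the scaling constant a
    real number. *)
Lemma ge0_integral_prod_indep (F : 'I_n -> T' -> R) :
  (forall i, measurable_fun [set: T'] (F i)) -> (forall i x, 0 <= F i x) ->
  (forall i, (\int[P]_w (F i (Z i w))%:E < +oo)%E) ->
  (\int[P]_w (\prod_(i < n) F i (Z i w))%:E =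
   \prod_(i < n) \int[P]_w (F i (Z i w))%:E)%E.
Proof.
(* Induction on [m]: only the factors of index at least [m] are still required to be indicators. The
   case [m = 0] is [indepZ], the case [m = n] is the claim. *)
suff H m : forall F : 'I_n -> T' -> R,
    (forall i, measurable_fun [set: T'] (F i)) -> (forall i x, 0 <= F i x) ->
    (forall i, (\int[P]_w (F i (Z i w))%:E < +oo)%E) ->
    (forall i : 'I_n, (m <= i)%N -> exists2 A, measurable A & F i = \1_A) ->
    (\int[P]_w (\prod_(i < n) F i (Z i w))%:E =
     \prod_(i < n) \int[P]_w (F i (Z i w))%:E)%E.
  by move=> mF F0 Foo; apply: (H n) => // i; rewrite leqNgt ltn_ord.
have mZA i A : measurable A -> measurable (Z i @^-1` A).
  by move=> mA; exact: measurable_funPTI.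
have intI i A : measurable A -> (\int[P]_w (\1_A (Z i w))%:E = P (Z i @^-1` A))%E.
  by move=> mA; rewrite -[in RHS](setIT (Z i @^-1` _)) -integral_indic//; exact: mZA.
elim: m => {F} [|m IH] F mF F0 Foo FA.
  have /choice[A AF] : forall i, exists A, measurable A /\ F i = \1_A.
    by move=> i; have [//|A mA FE] := FA i; exists A.
  have mA i : measurable (A i) by case: (AF i).
  transitivity (P (\bigcap_(i in [set: 'I_n]) (Z i @^-1` A i))).
    rewrite -[X in _ = P X]setIT -[in RHS]integral_indic//; last first.
      by apply: fin_bigcap_measurable => // i _; exact: mZA.
    apply: eq_integral => w _; congr EFin.
    rewrite [RHS]indicE; have [wA|wA] := boolP (w \in _).
      apply: big1 => i _; rewrite (AF i).2 indicE mem_set//.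
      by move: wA; rewrite inE => /(_ i); exact.
    have [i wAi] : exists i, ~ A i (Z i w).
      apply/existsNP => h; move/negP: wA; apply; rewrite inE => i _; exact: h.
    by apply/eqP; rewrite prodf_seq_eq0; apply/hasP; exists i => //=;
      rewrite ?mem_index_enum// (AF i).2 indicE memNset.
  rewrite indepZ//; apply: eq_bigr => i _.
  by rewrite -intI//; apply: eq_integral => w _; rewrite (AF i).2.
have [nm|mn] := leqP n m.
  by apply: IH => // i; rewrite leqNgt (leq_trans (ltn_ord i) nm).
pose i0 := Ordinal mn.
have intfin i : (\int[P]_w (F i (Z i w))%:E)%E \is a fin_num.
  by rewrite ge0_fin_numE//; apply: integral_ge0 => w _; rewrite lee_fin.
have prodE : (\prod_(i < n | i != i0) \int[P]_w (F i (Z i w))%:E =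
    (\prod_(i < n | i != i0) fine (\int[P]_w (F i (Z i w))%:E)%E)%R%:E)%E.
  by rewrite -prodEFin; apply: eq_bigr => i _; rewrite fineK.
under eq_integral do rewrite (bigD1 i0)//= mulrC.
rewrite [RHS](bigD1 i0)//= [RHS]muleC prodE.
apply: ge0_integral_scaled_law => //.
- under eq_fun do rewrite -big_filter.
  by apply: measurable_prod => i _; exact: mFZ.
- by move=> w; apply: prodr_ge0.
- move=> A mA.
  (* With factor [i0] turned back into an indicator [IH] applies, and yields the indicator case of
     the scaled law whose weight is the product of the other factors. *)
  pose F' i := if i == i0 then \1_A else F i.
  have F'0 : F' i0 = \1_A by rewrite /F' eqxx.
  have F'i i : i != i0 -> F' i = F i by rewrite /F' => /negPf ->.
  have mF' i : measurable_fun [set: T'] (F' i).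
    by rewrite /F'; case: ifP => // _; exact: measurable_indic.
  have F'ge0 i x : 0 <= F' i x by rewrite /F'; case: ifP.
  have F'oo i : (\int[P]_w (F' i (Z i w))%:E < +oo)%E.
    rewrite /F'; case: ifP => // _.
    by rewrite intI//; rewrite ltey_eq fin_num_measure//; exact: mZA.
  have F'A (i : 'I_n) : (m <= i)%N -> exists2 A, measurable A & F' i = \1_A.
    move=> mi; rewrite /F'; case: ifPn => [_|ii0]; first by exists A.
    by apply: FA; rewrite ltn_neqAle mi andbT; apply: contra ii0 => /eqP mE;
      apply/eqP/val_inj.
  have := IH F' mF' F'ge0 F'oo F'A; rewrite [RHS](bigD1 i0)//= F'0 [RHS]muleC.
  rewrite (eq_bigr (fun i => \int[P]_w (F i (Z i w))%:E)%E); last first.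
    by move=> i ii0; rewrite F'i.
  rewrite prodE => <-; apply: eq_integral => w _; congr EFin.
  rewrite [RHS](bigD1 i0)//= F'0 mulrC; congr (_ * _).
  by apply: eq_bigr => i ii0; rewrite F'i.
Qed.

End independence.

(** * Means of real random variables, and of products under independence *)

Section mean.
Context d (T : measurableType d) {R : realType} (P : probability T R).
Local Notation integ f := (P.-integrable [set: T] (EFin \o f)).
Local Notation E := (Rintegral P [set: T]).

Lemma integ_le (f g : T -> R) : measurable_fun [set: T] f ->
  (forall w, `|f w| <= g w) -> integ g -> integ f.
Proof.
move=> mf fg; apply: le_integrable => //; first exact/measurable_EFinP.
by move=> w _ /=; rewrite lee_fin (le_trans (fg w))// ler_norm.
Qed.

Lemma integ_cst (k : R) : integ (cst k : T -> R).
Proof. exact: finite_measure_integrable_cst. Qed.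

Lemma integ_bounded (f : T -> R) k : measurable_fun [set: T] f ->
  (forall w, `|f w| <= k) -> integ f.
Proof. by move=> mf fk; apply: (@integ_le _ (cst k)) => //; exact: integ_cst. Qed.

Lemma integ_mfun (f : T -> R) : integ f -> measurable_fun [set: T] f.
Proof. by move/(measurable_int P)/measurable_EFinP. Qed.

Lemma integD (f g : T -> R) : integ f -> integ g -> integ (fun w => f w + g w).
Proof. by move=> fi gi; apply: (integrableD measurableT fi gi). Qed.

Lemma integZ k (f : T -> R) : integ f -> integ (fun w => k * f w).
Proof. by move=> fi; apply: (integrableZl measurableT k fi). Qed.

Lemma integ_sum (I : Type) (s : seq I) (f : I -> T -> R) :
  (forall i, integ (f i)) -> integ (fun w => \sum_(i <- s) f i w).
Proof.
move=> fi; elim: s => [|i s IH].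
  by under eq_fun do rewrite big_nil; exact: integ_cst.
by under eq_fun do rewrite big_cons; apply: integD.
Qed.

Lemma mean_sum (I : Type) (s : seq I) (f : I -> T -> R) :
  (forall i, integ (f i)) -> E (fun w => \sum_(i <- s) f i w) = \sum_(i <- s) E (f i).
Proof.
move=> fi; elim: s => [|i s IH].
  by rewrite big_nil; under eq_Rintegral do rewrite big_nil; rewrite Rintegral_cst// mul0r.
rewrite big_cons -IH -RintegralD//; last exact: integ_sum.
by under eq_Rintegral do rewrite big_cons.
Qed.

Lemma mean_cst k : E (fun=> k) = k.
Proof. by rewrite Rintegral_cst// [X in fine X](@probability_setT _ _ _ P) mulr1. Qed.

Lemma mean_le (f g : T -> R) : integ f -> integ g -> (forall w, f w <= g w) ->
  E f <= E g.
Proof. by move=> fi gi fg; apply: le_Rintegral. Qed.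

Lemma markov_mean (g : T -> R) (x : R) : 0 < x -> integ g -> (forall w, 0 <= g w) ->
  (P [set w | (x <= g w)%R] <= (E g / x)%:E)%E.
Proof.
move=> x0 gi g0; have mg := integ_mfun gi.
have := @le_integral_abse _ _ _ P _ measurableT (EFin \o g) x _ x0.
rewrite setTI => /(_ _)/le_trans h.
rewrite EFinM muleC -lee_pdivrMl ?invr_gt0// invrK.
have -> : [set w | x <= g w] = [set w | (x%:E <= `|(EFin \o g) w|)%E].
  by apply/seteqP; split => w /=; rewrite lee_fin ger0_norm.
apply: h; first exact/measurable_EFinP.
rewrite /Rintegral fineK; last exact: integrable_fin_num.
by under eq_integral do rewrite /= ger0_norm//.
Qed.

Lemma measurable_bigmax (I : Type) (s : seq I) (D : set T) (f : I -> T -> R) :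
  (forall i, measurable_fun D (f i)) ->
  measurable_fun D (fun w => \big[Num.max/0]_(i <- s) f i w).
Proof.
move=> mf; elim: s => [|i s IH].
  by under eq_fun do rewrite big_nil; exact: measurable_cst.
by under eq_fun do rewrite big_cons; apply: measurable_maxr.
Qed.

End mean.

Section mean_indep.
Context d (T : measurableType d) d' (T' : measurableType d') {R : realType}.
Variables (P : probability T R) (n : nat) (Z : 'I_n -> {RV P >-> T'}).
Hypothesis indepZ : forall A : 'I_n -> set T', (forall i, measurable (A i)) ->
     P (\bigcap_(i in [set: 'I_n]) (Z i @^-1` A i)) =
     (\prod_(i < n) P (Z i @^-1` A i))%E.
Local Notation integ f := (P.-integrable [set: T] (EFin \o f)).
Local Notation E := (Rintegral P [set: T]).

(** Finite means of the factors make the product of integrals finite, so integrability of the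
    product is a conclusion. *)
Lemma mean_prod_indep (F : 'I_n -> T' -> R) :
  (forall i, measurable_fun [set: T'] (F i)) -> (forall i x, 0 <= F i x) ->
  (forall i, integ (fun w => F i (Z i w))) ->
  integ (fun w => \prod_(i < n) F i (Z i w)) /\
  E (fun w => \prod_(i < n) F i (Z i w)) = \prod_(i < n) E (fun w => F i (Z i w)).
Proof.
move=> mF F0 Fi.
have Fin i : (\int[P]_w (F i (Z i w))%:E)%E \is a fin_num.
  exact: (integrable_fin_num _ (Fi i)).
have := ge0_integral_prod_indep indepZ mF F0.
have -> : (\prod_(i < n) (\int[P]_w (F i (Z i w))%:E) =
    (\prod_(i < n) E (fun w => F i (Z i w)))%:E)%E.
  by rewrite -prodEFin; apply: eq_bigr => i _; rewrite fineK.
move=> /(_ _)/= h.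
have {}h : (\int[P]_w (\prod_(i < n) F i (Z i w))%:E =
   (\prod_(i < n) E (fun w => F i (Z i w)))%:E)%E.
  by apply: h => i; rewrite ltey_eq Fin.
split; last by rewrite {1}/Rintegral h.
apply/integrableP; split.
  apply/measurable_EFinP; apply: measurable_prod => i _.
  exact: measurableT_comp.
under eq_integral do rewrite /= ger0_norm ?prodr_ge0//.
by rewrite h ltry.
Qed.

Lemma mean_pair_indep i k (g h : T' -> R) : i != k ->
  measurable_fun [set: T'] g -> measurable_fun [set: T'] h ->
  (forall x, 0 <= g x) -> (forall x, 0 <= h x) ->
  integ (fun w => g (Z i w)) -> integ (fun w => h (Z k w)) ->
  E (fun w => g (Z i w) * h (Z k w)) =
  E (fun w => g (Z i w)) * E (fun w => h (Z k w)).
Proof.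
move=> ik mg mh g0 h0 gi hi.
pose F j : T' -> R := if j == i then g else if j == k then h else cst 1.
have [|||_] := @mean_prod_indep F.
- by move=> j; rewrite /F; case: ifP => // _; case: ifP.
- by move=> j x; rewrite /F; case: ifP => // _; case: ifP => //= _.
- move=> j; rewrite /F; case: eqP => [->//|_]; case: eqP => [->//|_].
  exact: integ_cst.
have ki : k != i by rewrite eq_sym.
have FE w : \prod_(j < n) F j (Z j w) = g (Z i w) * h (Z k w).
  rewrite (bigD1 i)//= (bigD1 k)//= big1 ?mulr1; last first.
    by move=> j /andP[/negPf ji /negPf jk]; rewrite /F ji jk.
  by rewrite /F eqxx (negPf ki) eqxx.
under eq_Rintegral do rewrite FE.
move=> ->; rewrite (bigD1 i)//= (bigD1 k)//= big1 ?mulr1; last first.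
  by move=> j /andP[/negPf ji /negPf jk]; rewrite /F ji jk mean_cst.
by rewrite /F eqxx (negPf ki) eqxx.
Qed.

End mean_indep.

(** Since [expR (- x) >= 1 - x], one has [expR x <= (1 - x)^-1]; and [(1 + x + 2 * x ^+ 2) * (1 - x)
    - 1 = x ^+ 2 * (1 - 2 * x)] is nonnegative. *)
Lemma expR_le_quad {R : realType} (x : R) : x <= 2^-1 ->
  expR x <= 1 + x + 2 * x ^+ 2.
Proof.
move=> x2; have x1 : 0 < 1 - x by lra.
have h := expR_ge1Dx (- x).
have e0 := expR_gt0 x.
have : expR x * (1 - x) <= 1.
  by rewrite -[leRHS](expRxMexpNx_1 x) ler_pM2l.
rewrite -ler_pdivlMr// => /le_trans; apply.
rewrite ler_pdivrMr// -subr_ge0.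
rewrite (_ : _ - 1 = x ^+ 2 * (1 - 2 * x)); last by ring.
by rewrite mulr_ge0 ?sqr_ge0//; lra.
Qed.

(** * Tail of a maximum of independent sums *)

Section concentration.
Context d (T : measurableType d) d' (T' : measurableType d') {R : realType}.
Variables (P : probability T R) (n : nat) (Z : 'I_n -> {RV P >-> T'}).
Hypothesis indepZ : forall A : 'I_n -> set T', (forall i, measurable (A i)) ->
     P (\bigcap_(i in [set: 'I_n]) (Z i @^-1` A i)) =
     (\prod_(i < n) P (Z i @^-1` A i))%E.
Local Notation integ f := (P.-integrable [set: T] (EFin \o f)).
Local Notation E := (Rintegral P [set: T]).

Variables (env : T' -> R) (tau : R).
Hypothesis menv : measurable_fun [set: T'] env.
Hypothesis env_ge0 : forall x, 0 <= env x.
Hypothesis env2_int : forall i, integ (fun w => env (Z i w) ^+ 2).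
Let mx w := \big[Num.max/0]_(i < n) env (Z i w).
Hypothesis tau_gt0 : 0 < tau.
Hypothesis tau_large : 2 * E (fun w => mx w ^+ 2) <= tau ^+ 2.

Let A := [set x | tau < env x].
Let big x := env x * \1_A x.
Let mean_big2 i := E (fun w => big (Z i w) ^+ 2).
Let b i := E (fun w => big (Z i w)).
Let EM := E (fun w => mx w ^+ 2).

Let mA : measurable A.
Proof.
rewrite /A (_ : [set x | _] = env @^-1` `]tau, +oo[%classic).
  by rewrite -[X in measurable X]setTI; exact: menv.
by apply/seteqP; split => x /=; rewrite in_itv/= andbT.
Qed.

Let mbig : measurable_fun [set: T'] big.
Proof. by apply: measurable_funM => //; exact: measurable_indic. Qed.

Let big_ge0 x : 0 <= big x. Proof. by rewrite mulr_ge0. Qed.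

Let bigE x : big x = if tau < env x then env x else 0.
Proof.
rewrite /big indicE; case: ifPn => h; first by rewrite mem_set// mulr1.
by rewrite memNset ?mulr0//; exact/negP.
Qed.

Let big_le x : big x <= env x.
Proof. by rewrite bigE; case: ifP. Qed.

Let big_tau x : big x <= big x ^+ 2 / tau.
Proof.
rewrite ler_pdivlMr// bigE; case: ifP => h; last by rewrite mul0r expr0n.
by rewrite expr2 ler_wpM2l// ltW.
Qed.

Let mZ (g : T' -> R) i : measurable_fun [set: T'] g ->
  measurable_fun [set: T] (fun w => g (Z i w)).
Proof. by move=> mg; exact: measurableT_comp. Qed.

Let int_big2 i : integ (fun w => big (Z i w) ^+ 2).
Proof.
apply: (integ_le _ _ (env2_int i)).
  by apply: measurable_funX; exact: mZ.
by move=> w; rewrite ger0_norm ?sqr_ge0// lerXn2r// ?nnegrE.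
Qed.

Lemma integ_env i : integ (fun w => env (Z i w)).
Proof.
apply: (@integ_le _ _ _ _ _ (fun w => 1 + env (Z i w) ^+ 2)); first exact: mZ.
  move=> w; rewrite ger0_norm//; have := sqr_ge0 (env (Z i w) - 1).
  by have := env_ge0 (Z i w); nra.
by apply: integD => //; exact: integ_cst.
Qed.

Let int_big i : integ (fun w => big (Z i w)).
Proof.
apply: (integ_le _ _ (integ_env i)); first exact: mZ.
by move=> w; rewrite ger0_norm.
Qed.

Let mmx : measurable_fun [set: T] mx.
Proof. by apply: measurable_bigmax => i; exact: mZ. Qed.

Let le_mx i w : env (Z i w) <= mx w.
Proof. exact: le_bigmax_cond. Qed.

Let mx_ge0 w : 0 <= mx w.
Proof. by rewrite /mx; elim/big_rec: _ => // i x _ x0; rewrite le_max env_ge0. Qed.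

Let int_mx2 : integ (fun w => mx w ^+ 2).
Proof.
apply: (@integ_le _ _ _ _ _ (fun w => \sum_(i < n) env (Z i w) ^+ 2)).
- exact: measurable_funX.
- move=> w; rewrite ger0_norm ?sqr_ge0//.
  rewrite /mx; elim/big_ind2: _ => [|x1 x2 y1 y2 h1 h2|i _].
  + by rewrite expr0n.
  + rewrite maxEle; case: ifP => _.
      by rewrite (le_trans h2)// lerDr (le_trans _ h1) ?sqr_ge0.
    by rewrite (le_trans h1)// lerDl (le_trans _ h2) ?sqr_ge0.
  + by [].
- exact: integ_sum.
Qed.

Let mC : measurable_fun [set: T'] (\1_(~` A) : T' -> R).
Proof. by apply: measurable_indic; exact: measurableC. Qed.

Let C_ge0 x : 0 <= \1_(~` A) x :> R. Proof. by rewrite indicE. Qed.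

Let C_le1 x : \1_(~` A) x <= 1 :> R. Proof. by rewrite indicE lern1 leq_b1. Qed.

Let int_C i : integ (fun w => \1_(~` A) (Z i w)).
Proof.
apply: (@integ_bounded _ _ _ _ _ 1); first exact: mZ.
by move=> w; rewrite ger0_norm// indicE lern1 leq_b1.
Qed.

(** By independence the product is the probability that no observation exceeds [tau]. The indicator
    of that event dominates [1 - mx ^+ 2 / tau ^+ 2], whose mean is at least 1/2 by [tau_large]. *)
Let probC_ge : 2^-1 <= \prod_(i < n) E (fun w => \1_(~` A) (Z i w)).
Proof.
have [iP <-] := @mean_prod_indep _ _ _ _ _ _ _ _ indepZ (fun=> \1_(~` A))
  (fun=> mC) (fun=> C_ge0) int_C.
have iM : integ (fun w => 1 + - tau ^- 2 * mx w ^+ 2).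
  by apply: integD; [exact: integ_cst|exact: integZ].
apply: (@le_trans _ _ (E (fun w => 1 + - tau ^- 2 * mx w ^+ 2))).
  rewrite RintegralD//; [|exact: integ_cst|exact: integZ].
  rewrite mean_cst RintegralZl// mulNr lerBrDl -lerBrDr.
  rewrite mulrC ler_pdivrMr ?exprn_gt0//; move: tau_large; lra.
apply: mean_le => // w.
have [h|] := boolP [forall i, Z i w \notin A].
  rewrite big1 ?gerDl ?mulNr ?oppr_le0 ?mulr_ge0 ?invr_ge0 ?sqr_ge0//.
  by move=> i _; rewrite indicE in_setC (forallP h).
move/forallPn => [i]; rewrite negbK inE => /= tm.
rewrite (@le_trans _ _ 0)//; last by rewrite prodr_ge0.
rewrite mulNr subr_le0 mulrC ler_pdivlMr ?exprn_gt0// mul1r.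
by rewrite lerXn2r ?nnegrE ?(ltW tau_gt0)// (le_trans (ltW tm)).
Qed.

Let meanC i : 0 <= E (fun w => \1_(~` A) (Z i w)) <= 1.
Proof.
rewrite Rintegral_ge0//= -[leRHS](mean_cst P 1); apply: mean_le => //.
exact: integ_cst.
Qed.

(* The events that only observation i exceeds tau are disjoint, and each of them
   has conditional probability at least 1/2 given that i exceeds tau. *)
Let sum_mean_big2 : \sum_(i < n) mean_big2 i <= 2 * EM.
Proof.
(* For fixed [i], the product over [j] is [big] squared at observation [i], restricted to the event
   that no other observation exceeds [tau]. *)
pose F (i j : 'I_n) : T' -> R := if j == i then (fun x => big x ^+ 2) else \1_(~` A).
have mF i j : measurable_fun [set: T'] (F i j).
  by rewrite /F; case: ifP => // _; exact: measurable_funX.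
have F0 i j x : 0 <= F i j x by rewrite /F; case: ifP => // _; exact: sqr_ge0.
have Fi i j : integ (fun w => F i j (Z j w)).
  by rewrite /F; case: ifP.
have FE i := mean_prod_indep indepZ (mF i) (F0 i) (Fi i).
have le1 i : mean_big2 i / 2 <= E (fun w => \prod_(j < n) F i j (Z j w)).
  rewrite (FE i).2 (bigD1 i)//= {1}/F eqxx ler_wpM2l//.
    by apply: Rintegral_ge0 => *; exact: sqr_ge0.
  rewrite [leRHS](eq_bigr (fun j => E (fun w => \1_(~` A) (Z j w)))); last first.
    by move=> j ji; rewrite /F (negPf ji).
  (* Leaving out factor [i], which is at most 1, can only increase the product, so the bound 1/2
     persists. *)
  rewrite (le_trans probC_ge)// (bigD1 i)//= ler_piMl//.
    by apply: prodr_ge0 => j _; case/andP: (meanC j).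
  by case/andP: (meanC i).
suff : \sum_(i < n) mean_big2 i / 2 <= EM by rewrite -mulr_suml ler_pdivrMr// mulrC.
apply: (le_trans (ler_sum _ (fun i _ => le1 i))).
rewrite -mean_sum; last by move=> i; case: (FE i).
apply: mean_le => //; first by apply: integ_sum => i; case: (FE i).
move=> w.
(* At each [w] at most one product survives: if the one for [i] is nonzero, every other
   [big (Z j w)] vanishes. The survivor is at most [mx w ^+ 2]. *)
have [h|] := boolP [forall i, \prod_(j < n) F i j (Z j w) == 0].
  by rewrite big1 ?sqr_ge0// => i _; apply/eqP; exact: (forallP h).
move/forallPn => [i]; rewrite prodf_seq_neq0 => /allP h.
have nA j : j != i -> Z j w \notin A.
  move=> ji; have := h j (mem_index_enum j); rewrite /F (negPf ji)/= indicE in_setC.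
  by case: (_ \in _) => //; rewrite eqxx.
rewrite (bigD1 i)//= [X in _ + X]big1 ?addr0; last first.
  move=> j ji; rewrite (bigD1 j)//= {1}/F eqxx bigE.
  move: (nA j ji); rewrite notin_setE /A/= => /negP/negPf ->.
  by rewrite expr0n mul0r.
rewrite (bigD1 i)//= {1}/F eqxx (@le_trans _ _ (big (Z i w) ^+ 2))//.
  rewrite ler_piMr ?sqr_ge0//; apply: prodr_ile1 => j ji.
  by rewrite F0 /F (negPf ji)/=.
by rewrite lerXn2r ?nnegrE// (le_trans (big_le _)).
Qed.

Let b_ge0 i : 0 <= b i. Proof. exact: Rintegral_ge0. Qed.

Let EM_ge0 : 0 <= EM. Proof. by apply: Rintegral_ge0 => w _; exact: sqr_ge0. Qed.

(** Where [big] is nonzero it exceeds [tau], so its first moment is at most its second moment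
    divided by [tau]. *)
Let sum_mean_big : \sum_(i < n) b i <= 2 * EM / tau.
Proof.
apply: (@le_trans _ _ ((\sum_(i < n) mean_big2 i) / tau)); last first.
  by rewrite ler_pM2r ?invr_gt0// sum_mean_big2.
rewrite mulr_suml; apply: ler_sum => i _; rewrite /mean_big2 -RintegralZr//.
apply: mean_le => //.
by under eq_fun do rewrite mulrC; exact: integZ.
Qed.

Let sum_mean_big_tau : \sum_(i < n) b i <= tau.
Proof.
by apply: (le_trans sum_mean_big); rewrite ler_pdivrMr// -expr2.
Qed.

Let S w := \sum_(i < n) big (Z i w).

Let S_ge0 w : 0 <= S w. Proof. by rewrite /S sumr_ge0. Qed.

Let int_bigM i k : integ (fun w => big (Z i w) * big (Z k w)).
Proof.
apply: (@integ_le _ _ _ _ _ (fun w => big (Z i w) ^+ 2 + big (Z k w) ^+ 2)).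
- by apply: measurable_funM; exact: mZ.
- move=> w; rewrite ger0_norm ?mulr_ge0//.
  have := sqr_ge0 (big (Z i w) - big (Z k w)).
  have := sqr_ge0 (big (Z i w)); have := sqr_ge0 (big (Z k w)); nra.
- exact: integD.
Qed.

Let S2E w : S w ^+ 2 = \sum_(i < n) \sum_(k < n) big (Z i w) * big (Z k w).
Proof. by rewrite expr2 /S big_distrlr. Qed.

Let int_S2 : integ (fun w => S w ^+ 2).
Proof.
by under eq_fun do rewrite S2E; apply: integ_sum => i; exact: integ_sum.
Qed.

(** The diagonal terms sum to at most [2 * EM]. By independence the others are at most the square of
    the sum of the [b i], hence at most [(2 * EM / tau) * tau]. *)
Let mean_S2 : E (fun w => S w ^+ 2) <= 4 * EM.
Proof.
have -> : E (fun w => S w ^+ 2) =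
    \sum_(i < n) \sum_(k < n) E (fun w => big (Z i w) * big (Z k w)).
  under eq_Rintegral do rewrite S2E.
  rewrite mean_sum; last by move=> i; exact: integ_sum.
  by apply: eq_bigr => i _; rewrite mean_sum.
apply: (@le_trans _ _ (\sum_(i < n) mean_big2 i + (\sum_(i < n) b i) ^+ 2)).
  rewrite expr2 big_distrlr -big_split/=; apply: ler_sum => i _.
  rewrite (bigD1 i)//= lerD//.
  rewrite [leRHS](bigD1 i)//= -[leLHS]add0r lerD ?mulr_ge0//.
  by apply: ler_sum => k ki; rewrite (mean_pair_indep indepZ)// eq_sym.
have b0 : 0 <= \sum_(i < n) b i by rewrite sumr_ge0.
have h : (\sum_(i < n) b i) ^+ 2 <= 2 * EM.
  rewrite expr2 (le_trans (ler_pM _ _ sum_mean_big sum_mean_big_tau))//.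
  by rewrite -mulrA mulVf ?mulr1 ?gt_eqF.
have := sum_mean_big2; rewrite -/EM; lra.
Qed.

Let heavy_tail x : 0 < x -> (P [set w | (x <= S w)%R] <= (4 * EM / x ^+ 2)%:E)%E.
Proof.
move=> x0; rewrite (_ : [set w | _] = [set w | (x ^+ 2 <= S w ^+ 2)%R]); last first.
  by apply/seteqP; split=> w /=; rewrite ler_pXn2r// nnegrE// ltW.
apply: (le_trans (markov_mean _ int_S2 _)); rewrite ?exprn_gt0//.
  by move=> w; exact: sqr_ge0.
by rewrite lee_fin ler_pM2r ?mean_S2// invr_gt0 exprn_gt0.
Qed.

Section truncated.
Variables (f : T' -> R) (s2 : R).
Hypothesis mf : measurable_fun [set: T'] f.
Hypothesis f_env : forall x, `|f x| <= env x.
Hypothesis s2_ge0 : 0 <= s2.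
Hypothesis mean_f : forall i, E (fun w => f (Z i w)) = 0.
Hypothesis var_f : forall i, E (fun w => f (Z i w) ^+ 2) <= s2.

Let U x := f x * \1_(~` A) x.
(** The Chernoff parameter: as [U] is bounded by [tau], the exponent [lam * U] stays in the range of
    [expR_le_quad]. *)
Let lam := (2 * tau)^-1.

Let UE x : U x = if tau < env x then 0 else f x.
Proof.
rewrite /U indicE in_setC; case: ifPn => h.
  by rewrite mem_set// mulr0.
by rewrite memNset ?mulr1//; exact/negP.
Qed.

Let mU : measurable_fun [set: T'] U. Proof. exact: measurable_funM. Qed.

Let int_f i : integ (fun w => f (Z i w)).
Proof. by apply: (integ_le _ _ (integ_env i)); [exact: mZ|]. Qed.

Let int_f2 i : integ (fun w => f (Z i w) ^+ 2).
Proof.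
apply: (integ_le _ _ (env2_int i)); first by apply: measurable_funX; exact: mZ.
by move=> w; rewrite normrX lerXn2r ?nnegrE.
Qed.

Let U_tau x : `|U x| <= tau.
Proof.
rewrite UE; case: ltP => h; first by rewrite normr0 ltW.
exact: le_trans h.
Qed.

Let U_f x : U x ^+ 2 <= f x ^+ 2.
Proof. by rewrite UE; case: ifP => // _; rewrite expr0n sqr_ge0. Qed.

Let int_U i : integ (fun w => U (Z i w)).
Proof. by apply: (@integ_bounded _ _ _ _ _ tau) => //; exact: mZ. Qed.

Let int_U2 i : integ (fun w => U (Z i w) ^+ 2).
Proof.
apply: (integ_le _ _ (int_f2 i)); first by apply: measurable_funX; exact: mZ.
by move=> w; rewrite ger0_norm ?sqr_ge0.
Qed.

(** Truncation spoils the centring of [f], but pointwise [U <= f + big], so the bias is at most the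
    mean of [big]. *)
Let mean_U i : E (fun w => U (Z i w)) <= b i.
Proof.
rewrite -[leRHS]add0r -(mean_f i) -RintegralD//; apply: mean_le => //.
  exact: integD.
move=> w; rewrite UE bigE; case: ifP => _; last by rewrite addr0.
by rewrite -lerBlDr sub0r lerNl (le_trans (ler_norm _))// normrN.
Qed.

Let lam_gt0 : 0 < lam. Proof. by rewrite invr_gt0 mulr_gt0. Qed.

Let lamU x : lam * U x <= 2^-1.
Proof.
rewrite /lam invfM -mulrA ler_piMr// mulrC ler_pdivrMr// mul1r.
exact: le_trans (ler_norm _) (U_tau _).
Qed.

Let g x := expR (lam * U x).

Let mg : measurable_fun [set: T'] g.
Proof. by apply: measurableT_comp => //; exact: measurable_funM. Qed.

Let int_g i : integ (fun w => g (Z i w)).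
Proof.
apply: (@integ_bounded _ _ _ _ _ (expR 2^-1)); first exact: mZ.
by move=> w; rewrite ger0_norm ?expR_ge0// ler_expR.
Qed.

Let mean_g i : E (fun w => g (Z i w)) <= expR (lam * b i + 2 * lam ^+ 2 * s2).
Proof.
apply: (le_trans _ (expR_ge1Dx _)).
apply: (@le_trans _ _ (E (fun w => 1 + (lam * U (Z i w) + 2 * lam ^+ 2 * U (Z i w) ^+ 2)))).
  apply: mean_le => //.
    by apply: integD; [exact: integ_cst|apply: integD; exact: integZ].
  move=> w; apply: (le_trans (expR_le_quad (lamU _))).
  by rewrite exprMn -addrA [2 * (_ * _)]mulrA.
rewrite RintegralD//; [|exact: integ_cst|by apply: integD; exact: integZ].
rewrite mean_cst RintegralD//; [|exact: integZ|exact: integZ].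
rewrite !RintegralZl// lerD2l lerD ?ler_pM2l// ?mulr_gt0 ?exprn_gt0//.
apply: le_trans (var_f i).
by apply: mean_le => // w; exact: U_f.
Qed.

(** Chernoff's bound with parameter [lam]. The biases contribute at most 1/2 to the exponent and the
    variances at most half of [n%:R * s2 / tau ^+ 2]; both are rounded up. *)
Lemma truncated_tail y :
  (P [set w | (y <= \sum_(i < n) U (Z i w))%R] <=
   (expR (1 + n%:R * s2 / tau ^+ 2 - y / (2 * tau)))%:E)%E.
Proof.
have gE w : \prod_(i < n) g (Z i w) = expR (lam * \sum_(i < n) U (Z i w)).
  by rewrite mulr_sumr expR_sum.
rewrite (_ : [set w | _] =
    [set w | (expR (lam * y) <= \prod_(i < n) g (Z i w))%R]); last first.
  by apply/seteqP; split=> w /=; rewrite gE ler_expR ler_pM2l.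
have [ig Eg] := mean_prod_indep indepZ (fun=> mg) (fun _ _ => expR_ge0 _) int_g.
apply: (le_trans (markov_mean (expR_gt0 _) ig _)).
  by move=> w; apply: prodr_ge0 => i _; exact: expR_ge0.
rewrite lee_fin -expRN Eg.
apply: (@le_trans _ _ (expR (\sum_(i < n) (lam * b i + 2 * lam ^+ 2 * s2)) *
    expR (- (lam * y)))).
  rewrite ler_pM2r ?expR_gt0// expR_sum; apply: ler_prod => i _.
  by rewrite mean_g andbT; apply: Rintegral_ge0 => w _; exact: expR_ge0.
rewrite -expRD ler_expR /lam [_^-1 * y]mulrC lerD2r big_split/= -mulr_sumr.
rewrite sumr_const card_ord lerD//.
  rewrite mulrC ler_pdivrMr ?mulr_gt0// mul1r (le_trans sum_mean_big_tau)//.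
  by rewrite ler_peMl ?ler1n// ltW.
have -> : 2 * (2 * tau)^-1 ^+ 2 * s2 *+ n = n%:R * s2 / tau ^+ 2 / 2.
  by rewrite -mulr_natl; field; rewrite gt_eqF.
by rewrite ler_pdivrMr// ler_peMr ?ler1n// divr_ge0 ?sqr_ge0// mulr_ge0.
Qed.

End truncated.

(** The part above [tau] is at most [S] for every [f j], so its exceptional event is paid for once.
    Only the truncated sums need a union bound, over [J] and the two signs. *)
Lemma sum_tail (J : finType) (f : J -> T' -> R) (s2 x y : R) :
  (forall j, measurable_fun [set: T'] (f j)) ->
  (forall j t, `|f j t| <= env t) -> 0 <= s2 ->
  (forall j i, E (fun w => f j (Z i w)) = 0) ->
  (forall j i, E (fun w => f j (Z i w) ^+ 2) <= s2) -> 0 < x ->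
  exists B, [/\ measurable B,
    (P B <= (4 * E (fun w => (\big[Num.max/0]_(i < n) env (Z i w)) ^+ 2) / x ^+ 2 +
      2 * #|J|%:R * expR (1 + n%:R * s2 / tau ^+ 2 - y / (2 * tau)))%:E)%E &
    forall w, ~ B w -> forall j, `|\sum_(i < n) f j (Z i w)| <= x + y].
Proof.
move=> mf f_env s20 Ef Vf x0.
set e := expR _.
pose H := [set w | x <= S w].
pose U j t := f j t * \1_(~` A) t.
pose C (sgn : bool) j := [set w | y <= \sum_(i < n) (-1) ^+ sgn * U j (Z i w)].
have mge (h : T -> R) z : measurable_fun [set: T] h -> measurable [set w | z <= h w].
  move=> mh; rewrite (_ : [set w | _] = h @^-1` `[z, +oo[%classic).
    by rewrite -[X in measurable X]setTI; exact: mh.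
  by apply/seteqP; split => w /=; rewrite in_itv/= andbT.
have mH : measurable H.
  by apply: mge; apply: measurable_sum => i; exact: mZ.
have mC' sgn j : measurable (C sgn j).
  apply: mge; apply: measurable_sum => i; apply: measurable_funM => //.
  by apply: (mZ (g := fun t => U j t)); exact: measurable_funM.
have PC sgn j : (P (C sgn j) <= e%:E)%E.
  have := @truncated_tail (fun t => (-1) ^+ sgn * f j t) s2 _ _ s20 _ _ y.
  under eq_set do under eq_bigr do rewrite -mulrA.
  apply.
  - exact: measurable_funM.
  - by move=> t; rewrite normrM normrX normrN1 expr1n mul1r.
  - move=> i; rewrite RintegralZl ?Ef ?mulr0//.
    by apply: (integ_le _ _ (integ_env i)); [exact: mZ|].
  - move=> i; rewrite (le_trans _ (Vf j i))//.
    by under eq_Rintegral do rewrite exprMn sqrr_sign mul1r.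
have PU (s : seq J) sgn : (P (\big[setU/set0]_(j <- s) C sgn j) <= ((size s)%:R * e)%:E)%E.
  elim: s => [|j s IH]; first by rewrite big_nil measure0 mul0r.
  rewrite big_cons (le_trans (measureU2 _ _ _))//; first exact: bigsetU_measurable.
  by rewrite /= -natr1 mulrDl mul1r addrC EFinD leeD.
pose D sgn := \big[setU/set0]_(j <- enum J) C sgn j.
have mD sgn : measurable (D sgn) by exact: bigsetU_measurable.
exists (H `|` (D false `|` D true)); split.
- by apply: measurableU => //; exact: measurableU.
- rewrite (le_trans (measureU2 _ _ _))//; first exact: measurableU.
  rewrite EFinD leeD//; first exact: heavy_tail.
  rewrite (le_trans (measureU2 _ _ _))// -mulrA mulr_natl mulr2n EFinD.
  by rewrite leeD// /D (le_trans (PU _ _))// -cardE.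
- move=> w /not_orP[wH /not_orP[w0 w1]] j.
  have wC sgn : ~ D sgn w -> \sum_(i < n) (-1) ^+ sgn * U j (Z i w) < y.
    move=> wD; rewrite ltNge; apply/negP => wy; apply: wD.
    by rewrite /D -bigcup_seq; exists j => //=; rewrite mem_enum.
  (* The second term is at most [big (Z i w)] in absolute value, hence sums to less than [x] outside
     [H]. *)
  have fE i : f j (Z i w) = U j (Z i w) + f j (Z i w) * \1_A (Z i w).
    rewrite /U !indicE in_setC; by case: (_ \in _); rewrite /= ?mulr0 ?mulr1 ?addr0 ?add0r.
  rewrite (eq_bigr _ (fun i _ => fE i)) big_split/=.
  rewrite (le_trans (ler_normD _ _))// addrC lerD//.
    rewrite (le_trans (ler_norm_sum _ _ _))//.
    move/negP : wH; rewrite -ltNge => /ltW; apply: le_trans.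
    apply: ler_sum => i _; rewrite normrM ler_pM//.
    by rewrite ger0_norm.
  move: (wC _ w0) (wC _ w1); rewrite -!mulr_sumr expr0 expr1 mul1r mulN1r.
  by rewrite ler_norml; lra.
Qed.

End concentration.

(** * Strong convexity *)

Section strong_convexity.
Context {R : realType}.
Variables (h : R -> R) (m : R).
Hypothesis dh : forall u, derivable h u 1.
Hypothesis ddh : forall u, derivable (derive1 h) u 1.

Let g := (h \- (fun u => m / 2 * u ^+ 2)) : R -> R^o.

Let dq (u : R) : is_derive u 1 (fun u : R => m / 2 * u ^+ 2) (m * u).
Proof.
apply: (is_derive_eq (is_deriveZ (m / 2) (is_deriveX 2 (is_derive_id u 1)))).
by rewrite /GRing.scale/= expr1; field.
Qed.

Let dg (u : R) : is_derive u 1 g ((derive1 h) u - m * u).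
Proof.
apply: is_deriveB; last exact: dq.
by rewrite derive1E; exact: derivableP.
Qed.

Let DgE : 'D_1 g = (derive1 h \- (fun u => m * u)).
Proof. by apply/funext => u; apply: derive_val. Qed.

Let ddg (u : R) : is_derive u 1 ('D_1 g) ((derive1 (derive1 h)) u - m).
Proof.
rewrite DgE; apply: is_deriveB.
  by rewrite derive1E; exact: derivableP.
apply: (is_derive_eq (is_deriveZ m (is_derive_id u 1))).
by rewrite /GRing.scale/= mulr1.
Qed.

(** [g] has nonnegative second derivative on the segment, hence is convex there. The quadratic gain
    comes from [t * a ^+ 2 + (1 - t) * b ^+ 2 - (t * a + (1 - t) * b) ^+ 2 = t * (1 - t) * (a - b)
    ^+ 2]. *)
Let strongly_convex_le (a b t : R) : a <= b -> 0 <= t <= 1 ->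
  (forall s, 0 <= s <= 1 -> m <= derive1 (derive1 h) (s * a + (1 - s) * b)) ->
  h (t * a + (1 - t) * b) <=
    t * h a + (1 - t) * h b - m / 2 * (t * (1 - t) * (a - b) ^+ 2).
Proof.
move=> ab /andP[t0 t1] hm.
have cg u : {for u, continuous g}.
  by apply/differentiable_continuous/derivable1_diffP; case: (dg u).
have H : g (t * a + (1 - t) * b) <= t * g a + (1 - t) * g b.
  apply: (@second_derivative_convex R g a b _ _ _ _ _ (Itv01 t0 t1) ab).
  - move=> x /andP[ax xb]; rewrite (@derive_val _ _ _ _ _ _ _ (ddg x)) subr_ge0.
    have ba0 : 0 < b - a by rewrite subr_gt0 (lt_trans ax).
    have -> : x = (b - x) / (b - a) * a + (1 - (b - x) / (b - a)) * b.
      by field; rewrite gt_eqF.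
    apply: hm; apply/andP; split.
      by apply: divr_ge0; rewrite subr_ge0 ltW// -subr_gt0.
    by rewrite ler_pdivrMr// mul1r lerD2l lerN2 ltW.
  - exact/cvg_at_left_filter/cg.
  - exact/cvg_at_right_filter/cg.
  - by move=> x _; case: (dg x).
  - by move=> x _; case: (ddg x).
pose c := t * a + (1 - t) * b.
have {}H : h c - m / 2 * c ^+ 2 <=
    t * (h a - m / 2 * a ^+ 2) + (1 - t) * (h b - m / 2 * b ^+ 2) := H.
rewrite -/c -subr_ge0; move: H; rewrite -subr_ge0 => /le_trans; apply.
by rewrite le_eqVlt; apply/orP; left; apply/eqP; rewrite /c; ring.
Qed.

(** Exchanging [a] with [b] and [t] with [1 - t] removes the ordering of the endpoints. *)
Lemma strongly_convex_segment (a b t : R) : 0 <= t <= 1 ->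
  (forall s, 0 <= s <= 1 -> m <= derive1 (derive1 h) (s * a + (1 - s) * b)) ->
  h (t * a + (1 - t) * b) <=
    t * h a + (1 - t) * h b - m / 2 * (t * (1 - t) * (a - b) ^+ 2).
Proof.
move=> t01 hm; have [ab|/ltW ba] := leP a b; first exact: strongly_convex_le.
have h1 : 0 <= 1 - t <= 1 by move: t01; lra.
have := strongly_convex_le ba h1.
rewrite subKr => H; rewrite addrC (le_trans (H _))//.
  move=> s s01; rewrite addrC -[s in _ + s * _](subKr 1); apply: hm.
  by move: s01; lra.
by rewrite le_eqVlt; apply/orP; left; apply/eqP; ring.
Qed.

End strong_convexity.

Section mean_strong_convexity.
Context d (T : measurableType d) {R : realType} (P : probability T R).
Local Notation integ f := (P.-integrable [set: T] (EFin \o f)).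
Local Notation E := (Rintegral P [set: T]).

(** The minimum of [f] and [g] equals [f] almost everywhere and is below [g] everywhere. *)
Lemma mean_le_ae (f g : T -> R) : integ f -> integ g ->
  {ae P, forall w, f w <= g w} -> E f <= E g.
Proof.
move=> fi gi fg.
have mf := integ_mfun fi; have mg := integ_mfun gi.
have mfg : measurable_fun [set: T] (fun w => Num.min (f w) (g w)).
  exact: measurable_minr.
have -> : E f = E (fun w => Num.min (f w) (g w)).
  congr fine; apply: ae_eq_integral => //; [exact/measurable_EFinP|exact/measurable_EFinP|].
  by apply: filterS fg => w fgw _ /=; congr EFin; rewrite min_l.
apply: mean_le => //; last by move=> w; rewrite ge_min lexx orbT.
apply: (@integ_le _ _ _ _ _ (fun w => `|f w| + `|g w|)) => //.
  by move=> w; rewrite minEle; case: ifP => _; rewrite ?lerDl ?lerDr.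
by apply: integD; exact: integrable_norm.
Qed.

(* Divide the convexity inequality at t by t and let t tend to 0. *)
Lemma mean_strong_convex (phi : R -> T -> R) (q : T -> R) (m : R) :
  0 <= m ->
  (forall t, 0 <= t <= 1 -> integ (phi t)) -> integ q -> (forall w, 0 <= q w) ->
  (forall t, 0 <= t <= 1 -> E (phi 0) <= E (phi t)) ->
  (forall t, 0 <= t <= 1 -> {ae P, forall w,
     phi t w <= t * phi 1 w + (1 - t) * phi 0 w - m * (t * (1 - t) * q w)}) ->
  m * E q <= E (phi 1) - E (phi 0).
Proof.
move=> m0 iphi iq q0 argmin conv.
have i0 : integ (phi 0) by apply: iphi; lra.
have i1 : integ (phi 1) by apply: iphi; lra.
have step t : 0 < t <= 1 -> m * (1 - t) * E q <= E (phi 1) - E (phi 0).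
  move=> /andP[t0 t1]; have t01 : 0 <= t <= 1 by lra.
  have DE : integ (fun w => t * phi 1 w + (1 - t) * phi 0 w - m * (t * (1 - t) * q w)) /\
     E (fun w => t * phi 1 w + (1 - t) * phi 0 w - m * (t * (1 - t) * q w)) =
       t * E (phi 1) + (1 - t) * E (phi 0) - m * (t * (1 - t)) * E q.
    have j1 : integ (fun w => t * phi 1 w) by exact: integZ.
    have j2 : integ (fun w => (1 - t) * phi 0 w) by exact: integZ.
    have j3 : integ (fun w => - (m * (t * (1 - t))) * q w) by exact: integZ.
    have j12 := integD j1 j2; have j123 := integD j12 j3.
    have eqf : (fun w => t * phi 1 w + (1 - t) * phi 0 w - m * (t * (1 - t) * q w)) =
       (fun w => t * phi 1 w + (1 - t) * phi 0 w + - (m * (t * (1 - t))) * q w).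
      by apply/funext => w; ring.
    rewrite eqf; split => //.
    by rewrite RintegralD// RintegralD// !RintegralZl// mulNr.
  case: DE => iD ED.
  have := le_trans (argmin t t01) (mean_le_ae (iphi t t01) iD (conv t t01)).
  rewrite ED => H.
  rewrite -(ler_pM2l t0); lra.
have q_ge0 : 0 <= E q by apply: Rintegral_ge0.
have D0 : E (phi 0) <= E (phi 1) by apply: argmin; rewrite ler01 lexx.
rewrite leNgt; apply/negP => lt.
set c := m * E q in lt; set D := E (phi 1) - E (phi 0) in lt step.
have c0 : 0 < c by apply: le_lt_trans lt; rewrite /D subr_ge0.
have D1 : 0 <= D by rewrite /D subr_ge0.
(* An explicit small [t] stands in for the limit: if [D < c], it turns [c * (1 - t) <= D] into
   [(c + D) / 2 <= D], a contradiction. *)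
have t0 : 0 < (c - D) / (2 * c) by apply: divr_gt0; lra.
have t1 : (c - D) / (2 * c) <= 1.
  by rewrite ler_pdivrMr; lra.
have := step _ (introT andP (conj t0 t1)).
rewrite mulrAC -/c mulrBr mulr1 (_ : c * _ = (c - D) / 2); last first.
  by field; rewrite gt_eqF.
lra.
Qed.

End mean_strong_convexity.

(** * The cone norm at the origin and nonemptiness of the active set *)

Section cone.
Context {R : realType} {p : nat} (A : set 'cV[R]_p).
Hypothesis coneA : positive_convex_cone A.

(** At the origin the objective is half the sum of the entries of [a]; scaling [a] down within the
    cone makes it arbitrarily small. *)
Lemma cone_norm0 : cone_norm A 0 = 0.
Proof.
case: coneA => -[a Aa] Apos _ Ascale.
pose F (a : 'cV[R]_p) := 2^-1 * \sum_j ((0 : 'cV[R]_p) j 0 ^+ 2 / a j 0 + a j 0).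
have FE a' : F a' = 2^-1 * \sum_j a' j 0.
  by congr (_ * _); apply: eq_bigr => j _; rewrite mxE expr0n mul0r add0r.
have F0 a' : A a' -> 0 <= F a'.
  move=> Aa'; rewrite FE mulr_ge0 ?invr_ge0// sumr_ge0// => j _.
  exact/ltW/Apos.
have lb : lbound (F @` A) 0 by move=> _ [a' Aa' <-]; exact: F0.
rewrite /cone_norm -/F; apply/eqP; rewrite eq_le; apply/andP; split; last first.
  by apply: lb_le_inf; first by exists (F a), a.
have le t : 0 < t -> inf (F @` A) <= t * F a.
  move=> t0; apply: ge_inf; first by exists 0.
  exists (t *: a); first exact: Ascale.
  rewrite !FE mulrCA; congr (_ * _); rewrite mulr_sumr.
  by apply: eq_bigr => j _; rewrite mxE.
apply/ler_addgt0Pl => e e0; rewrite addr0.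
apply: (le_trans (le (e / (1 + F a)) _)).
  by rewrite divr_gt0// ltr_pwDl// F0.
have h : 0 < 1 + F a by rewrite ltr_pwDl// F0.
by rewrite mulrAC ler_pdivrMr// ler_pM2l// lerDr.
Qed.

(** For empty [S] the constraint asks that the cone norm of 0 be 1, so the infimum runs over the
    empty set; it is 0 by convention, and so is its inverse. *)
Lemma Gamma2_card0 d (T : measurableType d) (P : probability T R) n
    (Z : 'I_n -> {RV P >-> (R * p.-tuple R)%type}) (S : {set 'I_p}) OmSc L :
  #|S| = 0%N -> @Gamma2 d T R P n p Z (cone_norm A) S OmSc L = 0.
Proof.
move=> /eqP; rewrite cards_eq0 => /eqP S0; rewrite /Gamma2.
rewrite (_ : [set _ | _ in _] = set0) ?inf0 ?invr0//.
rewrite -subset0 => g [b [+ _] _].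
rewrite (_ : keep S b = 0) ?cone_norm0; first by move=> /esym/eqP; rewrite oner_eq0.
by apply/colP => j; rewrite !mxE S0 inE.
Qed.

End cone.

(** * Means under equality in law, and elementary inequalities *)

Section identically_distributed.
Context d (T : measurableType d) d' (T' : measurableType d') {R : realType}.
Variables (P : probability T R) (X Y : {RV P >-> T'}).
Hypothesis same_law : forall A, measurable A -> P (X @^-1` A) = P (Y @^-1` A).
Local Notation integ f := (P.-integrable [set: T] (EFin \o f)).
Local Notation E := (Rintegral P [set: T]).

Lemma mean_same_law (f : T' -> R) : measurable_fun [set: T'] f ->
  integ (f \o X) -> integ (f \o Y) /\ E (f \o X) = E (f \o Y).
Proof.
move=> mf fX; have mEf : measurable_fun [set: T'] (EFin \o f) by exact/measurable_EFinP.
have fY : integ (f \o Y).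
  apply/integrableP; split.
    by apply/measurable_EFinP; exact: measurableT_comp.
  have mabs : measurable_fun [set: T'] (abse \o (EFin \o f)) by exact: measurableT_comp.
  rewrite -(ge0_integral_distribution Y mabs)//; last by move=> t; exact: abse_ge0.
  rewrite (eq_measure_integral (distribution P X)); last first.
    by move=> A mA _; exact/esym/same_law.
  rewrite ge0_integral_distribution//; last by move=> t; exact: abse_ge0.
  by have /integrableP[_ h] := fX; exact: h.
split=> //; congr fine.
rewrite -[LHS](integral_distribution mEf)// -[RHS](integral_distribution mEf)//.
apply: eq_measure_integral => A mA _.
exact: same_law.
Qed.

End identically_distributed.

(** Reduces the moment of order [r] to a fourth moment, which controls the variance of a product of
    two coordinates. *)
Lemma expr4_le_powR {R : realType} (x r : R) : 4 <= r ->
  x ^+ 4 <= 1 + `|x| `^ r.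
Proof.
move=> r4; rewrite -[leLHS]ger0_norm ?exprn_even_ge0// normrX.
have [x1|x1] := leP `|x| 1.
  by rewrite (@le_trans _ _ 1) ?exprn_ile1// lerDl powR_ge0.
rewrite -powR_mulrn// (le_trans (ler_powR _ r4)) ?ltW// ltrDr//.
Qed.

(** Gives [1 <= 2 * ln p] for [p >= 2], which absorbs additive constants in exponents. *)
Lemma half_le_ln2 {R : realType} : 2^-1 <= ln 2 :> R.
Proof.
rewrite -ler_expR lnK ?posrE// (le_trans (expR_le_quad _))//.
by rewrite le_eqVlt; apply/orP; left; apply/eqP; field.
Qed.

(** * Deviation of the empirical Gram matrix *)

Section gram.
Context d (T : measurableType d) {R : realType} (P : probability T R).
Variables (n p : nat) (Z : 'I_n.+1 -> {RV P >-> (R * p.-tuple R)%type}).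
Hypothesis Z_iid : iid Z.
Variables (r Cx : R).
Hypothesis r_ge4 : 4 <= r.
Hypothesis X_moment : forall j,
  ('E_P[fun w => (`|design Z w ord0 j| `^ r)%R] <= Cx%:E)%E.
Local Notation integ f := (P.-integrable [set: T] (EFin \o f)).
Local Notation E := (Rintegral P [set: T]).
Let obs := (R * p.-tuple R)%type.

Let coord j (z : obs) : R := tnth z.2 j.
Let sigma j l := E (fun w => coord j (Z ord0 w) * coord l (Z ord0 w)).

Let mcoord j : measurable_fun [set: obs] (coord j).
Proof.
apply: (measurableT_comp (f := fun t : p.-tuple R => tnth t j) (g := snd)).
  exact: measurable_tnth.
exact: measurable_snd.
Qed.

Let mZ (g : obs -> R) i : measurable_fun [set: obs] g ->
  measurable_fun [set: T] (fun w => g (Z i w)).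
Proof. by move=> mg; exact: measurableT_comp. Qed.

Let designE w i j : design Z w i j = coord j (Z i w).
Proof. by rewrite mxE. Qed.

Let same_law i k A : measurable A -> P (Z i @^-1` A) = P (Z k @^-1` A).
Proof. by move=> mA; case: Z_iid => _; apply. Qed.

Let mean_same i k (g : obs -> R) : measurable_fun [set: obs] g ->
  integ (fun w => g (Z i w)) ->
  integ (fun w => g (Z k w)) /\
  E (fun w => g (Z i w)) = E (fun w => g (Z k w)).
Proof. by move=> mg; exact: (mean_same_law (@same_law i k)). Qed.

Let powr_int j : integ (fun w => `|coord j (Z ord0 w)| `^ r) /\
  E (fun w => `|coord j (Z ord0 w)| `^ r) <= Cx.
Proof.
have := X_moment j; rewrite unlock.
under eq_integral do rewrite designE.
move=> h; split.
  apply/integrableP; split.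
    apply/measurable_EFinP.
    apply: (@measurableT_comp _ _ _ _ _ _ (fun x : R => x `^ r)) => //.
    by apply: measurableT_comp => //; exact: mZ.
  under eq_integral do rewrite /= ger0_norm ?powR_ge0//.
  by rewrite (le_lt_trans h) ?ltry.
have h0 : (0 <= \int[P]_w (`|coord j (Z ord0 w)| `^ r)%:E)%E.
  by apply: integral_ge0 => w _; rewrite lee_fin powR_ge0.
by rewrite -lee_fin fineK// ge0_fin_numE// (le_lt_trans h) ?ltry.
Qed.

Let X4_int j : integ (fun w => coord j (Z ord0 w) ^+ 4) /\
  E (fun w => coord j (Z ord0 w) ^+ 4) <= 1 + Cx.
Proof.
have [ip Ep] := powr_int j.
have i1 : integ (fun w => 1 + `|coord j (Z ord0 w)| `^ r).
  by apply: integD => //; exact: integ_cst.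
have le w : coord j (Z ord0 w) ^+ 4 <= 1 + `|coord j (Z ord0 w)| `^ r.
  exact: expr4_le_powR.
have i4 : integ (fun w => coord j (Z ord0 w) ^+ 4).
  apply: (integ_le _ _ i1); first by apply: measurable_funX; exact: mZ.
  by move=> w; rewrite ger0_norm ?exprn_even_ge0.
split => //; apply: (le_trans (mean_le i4 i1 le)).
by rewrite RintegralD//; [rewrite mean_cst lerD2l|exact: integ_cst].
Qed.

Let XX2_int j l : integ (fun w => (coord j (Z ord0 w) * coord l (Z ord0 w)) ^+ 2) /\
  E (fun w => (coord j (Z ord0 w) * coord l (Z ord0 w)) ^+ 2) <= 1 + Cx.
Proof.
have [ij Ej] := X4_int j; have [il El] := X4_int l.
have i1 : integ (fun w => 2^-1 * coord j (Z ord0 w) ^+ 4 + 2^-1 * coord l (Z ord0 w) ^+ 4).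
  by apply: integD; exact: integZ.
have le w : (coord j (Z ord0 w) * coord l (Z ord0 w)) ^+ 2 <=
    2^-1 * coord j (Z ord0 w) ^+ 4 + 2^-1 * coord l (Z ord0 w) ^+ 4.
  have := sqr_ge0 (coord j (Z ord0 w) ^+ 2 - coord l (Z ord0 w) ^+ 2).
  rewrite sqrrB -!exprM exprMn; lra.
have i2 : integ (fun w => (coord j (Z ord0 w) * coord l (Z ord0 w)) ^+ 2).
  apply: (integ_le _ _ i1).
    by apply: measurable_funX; apply: measurable_funM; exact: mZ.
  by move=> w; rewrite ger0_norm ?sqr_ge0.
split=> //; apply: (le_trans (mean_le i2 i1 le)).
rewrite RintegralD//; [|exact: integZ|exact: integZ].
rewrite !RintegralZl//; lra.
Qed.

Let XX_int j l : integ (fun w => coord j (Z ord0 w) * coord l (Z ord0 w)).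
Proof.
have [i2 _] := XX2_int j l.
apply: (@integ_le _ _ _ _ _ (fun w => 1 + (coord j (Z ord0 w) * coord l (Z ord0 w)) ^+ 2)).
- by apply: measurable_funM; exact: mZ.
- move=> w; set x := _ * _; rewrite ler_norml.
  have := sqr_ge0 (x - 1); have := sqr_ge0 (x + 1).
  by rewrite sqrrB sqrrD; lra.
- by apply: integD => //; exact: integ_cst.
Qed.

Let f (jl : 'I_p * 'I_p) (z : obs) := coord jl.1 z * coord jl.2 z - sigma jl.1 jl.2.

Let mf jl : measurable_fun [set: obs] (f jl).
Proof. by apply: measurable_funB => //; exact: measurable_funM. Qed.

Let f_facts jl i : [/\ integ (fun w => f jl (Z i w)),
  integ (fun w => f jl (Z i w) ^+ 2),
  E (fun w => f jl (Z i w)) = 0 & E (fun w => f jl (Z i w) ^+ 2) <= 1 + Cx].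
Proof.
case: jl => j l.
have iXX := XX_int j l; have [iXX2 EXX2] := XX2_int j l.
have iN : integ (cst (- sigma j l) : T -> R) by exact: integ_cst.
have i1 : integ (fun w => f (j, l) (Z ord0 w)) by exact: (integD iXX iN).
have E1 : E (fun w => f (j, l) (Z ord0 w)) = 0.
  by rewrite [LHS](RintegralD _ iXX iN)// mean_cst subrr.
have eq2 w : f (j, l) (Z ord0 w) ^+ 2 =
    (coord j (Z ord0 w) * coord l (Z ord0 w)) ^+ 2
    + (- (2 * sigma j l) * (coord j (Z ord0 w) * coord l (Z ord0 w)) + sigma j l ^+ 2).
  by rewrite /f/=; ring.
have iB : integ (fun w => - (2 * sigma j l) * (coord j (Z ord0 w) * coord l (Z ord0 w))).
  exact: integZ.
have iC : integ (cst (sigma j l ^+ 2) : T -> R) by exact: integ_cst.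
have i2 : integ (fun w => f (j, l) (Z ord0 w) ^+ 2).
  by under eq_fun do rewrite eq2; apply: integD => //; exact: (integD iB iC).
have E2 : E (fun w => f (j, l) (Z ord0 w) ^+ 2) <= 1 + Cx.
  under eq_Rintegral do rewrite eq2.
  rewrite RintegralD//; last exact: (integD iB iC).
  rewrite [X in _ + X](RintegralD _ iB iC)// mean_cst RintegralZl// -/(sigma j l).
  have := sqr_ge0 (sigma j l); lra.
(* The moment assumption concerns the first observation; equality in law carries the facts over to
   observation [i]. *)
have [i1' <-] := mean_same i (mf (j, l)) i1.
have [i2' <-] := mean_same i (measurable_funX 2 (mf (j, l))) i2.
by [].
Qed.

Let env z := \big[Num.max/0]_(jl : 'I_p * 'I_p) `|f jl z|.

Let menv : measurable_fun [set: obs] env.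
Proof. by apply: measurable_bigmax => jl; exact: measurableT_comp. Qed.

Let env_ge0 z : 0 <= env z.
Proof. by rewrite /env; elim/big_rec: _ => // jl x _ x0; rewrite le_max x0 orbT. Qed.

Let f_env jl z : `|f jl z| <= env z. Proof. exact: le_bigmax_cond. Qed.

Let env2_int i : integ (fun w => env (Z i w) ^+ 2).
Proof.
apply: (@integ_le _ _ _ _ _ (fun w => \sum_(jl : 'I_p * 'I_p) f jl (Z i w) ^+ 2)).
- by apply: measurable_funX; exact: mZ.
- move=> w; rewrite ger0_norm ?sqr_ge0//.
  rewrite /env; elim/big_ind2: _ => [|x1 x2 y1 y2 h1 h2|jl _].
  + by rewrite expr0n.
  + rewrite maxEle; case: ifP => _.
      by rewrite (le_trans h2)// lerDr (le_trans _ h1) ?sqr_ge0.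
    by rewrite (le_trans h1)// lerDl (le_trans _ h2) ?sqr_ge0.
  + by rewrite real_normK ?num_real.
- by apply: integ_sum => jl; case: (f_facts jl i).
Qed.

(** [M1] centres with the mean at observation [i] and [env] with that at the first one; these agree
    by equality in law. The nested maxima over [j] and [l] become one over pairs. *)
Let M1E w : M1 Z w = \big[Num.max/0]_(i < n.+1) env (Z i w).
Proof.
have cE i j l : fine 'E_P[fun v => design Z v i j * design Z v i l] = sigma j l.
  rewrite unlock; transitivity (E (fun v => coord j (Z i v) * coord l (Z i v))).
    by congr fine; apply: eq_integral => v _; rewrite !designE.
  have mg : measurable_fun [set: obs] (fun z => coord j z * coord l z).
    exact: measurable_funM.
  by have [_ <-] := mean_same i mg (XX_int j l).
rewrite /M1; apply: eq_bigr => i _.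
have ge0 j : 0 <= \big[Num.max/0]_(l < p)
    `|design Z w i j * design Z w i l - fine 'E_P[fun v => design Z v i j * design Z v i l]|.
  by elim/big_rec: _ => // l x _ x0; rewrite le_max x0 orbT.
apply/eqP; rewrite eq_le; apply/andP; split.
  apply: bigmax_le => // j _; apply: bigmax_le => // l _.
  by rewrite cE !designE; exact: (f_env (j, l)).
apply: bigmax_le => [|[j l] _].
  by elim/big_rec: _ => // j x _ x0; rewrite le_max x0 orbT.
apply: (bigmax_sup j) => //; apply: (bigmax_sup l) => //.
by rewrite cE !designE.
Qed.

Let second_momentE :
  second_moment P (M1 Z) = E (fun w => (\big[Num.max/0]_(i < n.+1) env (Z i w)) ^+ 2).
Proof.
rewrite /second_moment unlock; congr fine.
by apply: eq_integral => w _; rewrite M1E.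
Qed.

Let indexE i w b : xb Z i w b = \sum_j coord j (Z i w) * b j 0.
Proof. by rewrite /xb mxE; apply: eq_bigr => j _; rewrite designE. Qed.

Let index2E i w b : xb Z i w b ^+ 2 =
  \sum_(jl : 'I_p * 'I_p) b jl.1 0 * b jl.2 0 * (coord jl.1 (Z i w) * coord jl.2 (Z i w)).
Proof.
rewrite expr2 indexE big_distrlr pair_bigA/=.
by apply: eq_bigr => -[j l] _ /=; ring.
Qed.

Lemma integ_xb2 b : integ (fun w => xb Z ord0 w b ^+ 2).
Proof.
under eq_fun do rewrite index2E.
by apply: integ_sum => jl; exact: integZ.
Qed.

Lemma gram_deviation b w x :
  (forall jl, `|\sum_(i < n.+1) f jl (Z i w)| <= x) ->
  empnorm2 (design Z w *m b) <=
    E (fun w => xb Z ord0 w b ^+ 2) + x / n.+1%:R * l1norm b ^+ 2.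
Proof.
move=> fx.
have qE : E (fun w => xb Z ord0 w b ^+ 2) =
    \sum_(jl : 'I_p * 'I_p) b jl.1 0 * b jl.2 0 * sigma jl.1 jl.2.
  under eq_Rintegral do rewrite index2E.
  rewrite mean_sum; last by move=> jl; exact: integZ.
  by apply: eq_bigr => -[j l] _; rewrite RintegralZl.
have eE : empnorm2 (design Z w *m b) = (\sum_(i < n.+1) xb Z i w b ^+ 2) / n.+1%:R.
  rewrite /empnorm2 mxE; congr (_ / _); apply: eq_bigr => i _.
  by rewrite /xb !mxE expr2.
have n0 : (0 : R) < n.+1%:R by rewrite ltr0n.
rewrite eE ler_pdivrMr// mulrDl mulrAC divfK ?gt_eqF//.
have -> : \sum_(i < n.+1) xb Z i w b ^+ 2 = E (fun w => xb Z ord0 w b ^+ 2) * n.+1%:R +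
   \sum_(jl : 'I_p * 'I_p) b jl.1 0 * b jl.2 0 * \sum_(i < n.+1) f jl (Z i w).
  under eq_bigr do rewrite index2E.
  rewrite exchange_big/= qE mulr_suml -big_split; apply: eq_bigr => -[j l] _ /=.
  rewrite -mulr_sumr -[_ * sigma _ _ * _]mulrA -mulrDr; congr (_ * _).
  by rewrite big_split/= sumr_const card_ord mulNrn -mulr_natr; ring.
rewrite lerD2l /l1norm expr2 big_distrlr/= pair_bigA/= mulr_sumr.
apply: ler_sum => -[j l] _ /=.
rewrite (le_trans (ler_norm _))// !normrM mulrC.
by apply: ler_wpM2r; rewrite ?mulr_ge0.
Qed.

(** One event serves all [b] at once, because it controls the entrywise deviations of the Gram
    matrix. *)
Lemma gram_concentration (D : R) : (1 < p)%N -> 0 < D ->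
  second_moment P (M1 Z) * ln p%:R / n.+1%:R <= D ->
  let u := ln p%:R in
  let Adev := 2 * Num.sqrt (2 * D) * ((1 + `|Cx|) / (2 * D) + 7) + 1 in
  exists B, [/\ measurable B,
    ((1 - 1 / p%:R `^ (2 * 1) - 16 * D / (4 * u ^+ 2))%:E <= P B)%E &
    forall w, B w -> forall b,
      empnorm2 (design Z w *m b) <= E (fun w => xb Z ord0 w b ^+ 2) +
        Adev * Num.sqrt u / Num.sqrt n.+1%:R * l1norm b ^+ 2].
Proof.
move=> p1 D0 MD u Adev.
pose N : R := n.+1%:R.
have N0 : 0 < N by rewrite ltr0n.
have u2 : 2^-1 <= u.
  rewrite (le_trans half_le_ln2)// ler_ln ?posrE ?ltr0n ?ler_nat//.
  exact: ltnW.
have u0 : 0 < u by lra.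
pose s2 : R := 1 + `|Cx|.
(* The smallest truncation level with 2 E M1^2 <= tau^2 that D guarantees. *)
pose tau := Num.sqrt (2 * D * (N / u)).
have Nu0 : 0 < N / u by exact: divr_gt0.
have DNu0 : 0 < 2 * D * (N / u) by rewrite mulr_gt0// mulr_gt0.
have tauE : tau = Num.sqrt (2 * D) * (Num.sqrt N / Num.sqrt u).
  by rewrite /tau sqrtrM ?sqrtrM ?sqrtrV// ltW// mulr_gt0.
have tau0 : 0 < tau by rewrite sqrtr_gt0.
have tau2 : tau ^+ 2 = 2 * D * (N / u) by rewrite sqr_sqrtr// ltW.
set EM := second_moment P (M1 Z) in MD.
have EM_le : EM <= D * (N / u).
  by rewrite mulrA ler_pdivlMr// -ler_pdivrMr.
have tau_large : 2 * E (fun w => (\big[Num.max/0]_(i < n.+1) env (Z i w)) ^+ 2) <= tau ^+ 2.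
  by rewrite -second_momentE -/EM tau2 -mulrA ler_pM2l.
(* With this level the heavy part has probability at most [4 * EM / x ^+ 2 <= 4 * D / u ^+ 2], which
   is the [16 * D / (4 * u ^+ 2)] of the statement. *)
pose x := Num.sqrt (N * u).
have x0 : 0 < x by rewrite sqrtr_gt0 mulr_gt0.
have xE : x = Num.sqrt N * Num.sqrt u by rewrite /x sqrtrM// ltW.
have x2 : x ^+ 2 = N * u by rewrite sqr_sqrtr// ltW// mulr_gt0.
(* The summand [s2 / (2 * D)] cancels the variance term, and 7 leaves the exponent [1 - 7 * u].
   Since [2 <= expR u], [p ^ 2 = expR (2 * u)] and [1 <= 2 * u], the union bound is at most
   [expR (- (2 * u))], that is [p ^ -2]. *)
pose y := 2 * Num.sqrt (2 * D) * (s2 / (2 * D) + 7) * x.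
have [|||B [mB PB Bdev]] := sum_tail (proj1 Z_iid) menv env_ge0 env2_int tau0 tau_large
  (s2 := s2) y mf f_env _ _ _ x0.
- by rewrite addr_ge0.
- by move=> jl i; case: (f_facts jl i).
- move=> jl i; case: (f_facts jl i) => _ _ _ /le_trans; apply.
  by rewrite lerD2l ler_norm.
exists (~` B); split; first exact: measurableC.
- have Bfin : P B \is a fin_num by exact: fin_num_measure.
  rewrite probability_setC// -(fineK Bfin) -EFinB lee_fin -addrA -opprD lerD2l lerN2.
  move: PB; rewrite -(fineK Bfin) lee_fin => /le_trans; apply.
  have sN0 : Num.sqrt N != 0 by rewrite gt_eqF// sqrtr_gt0.
  have su0 : Num.sqrt u != 0 by rewrite gt_eqF// sqrtr_gt0.
  have sD0 : Num.sqrt (2 * D) != 0 by rewrite gt_eqF// sqrtr_gt0 mulr_gt0.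
  have su : Num.sqrt u ^+ 2 = u by rewrite sqr_sqrtr// ltW.
  have D_neq0 : D != 0 by rewrite gt_eqF.
  have N_neq0 : 1 + n%:R != 0 :> R by rewrite nat1r gt_eqF.
  have u_neq0 : u != 0 by rewrite gt_eqF.
  rewrite addrC lerD//.
    have -> : 1 + N * s2 / tau ^+ 2 - y / (2 * tau) = 1 - 7 * u.
      rewrite tau2 tauE /y xE.
      have -> : 2 * Num.sqrt (2 * D) * (s2 / (2 * D) + 7) * (Num.sqrt N * Num.sqrt u) /
          (2 * (Num.sqrt (2 * D) * (Num.sqrt N / Num.sqrt u))) =
          (s2 / (2 * D) + 7) * Num.sqrt u ^+ 2.
        by field; rewrite sN0 su0 sD0 D_neq0.
      by rewrite su; field; rewrite N_neq0 u_neq0 D_neq0.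
    have pE : p%:R = expR u by rewrite lnK// posrE ltr0n ltnW.
    rewrite mulr1 powR_mulrn// card_prod card_ord natrM pE div1r -expRM_natl -expRN.
    have e2 : 2 <= expR u by rewrite -pE ler_nat.
    apply: (@le_trans _ _ (expR u * (expR u * expR u) * expR (2 * u - 7 * u))).
      apply: ler_pM; rewrite ?mulr_ge0 ?expR_ge0//.
        by rewrite ler_pM2r// mulr_gt0 ?expR_gt0.
      by rewrite ler_expR; lra.
    by rewrite -!expRD ler_expR; lra.
  rewrite -second_momentE -/EM x2 ler_pdivrMr ?mulr_gt0//.
  rewrite (_ : 16 * D / _ * _ = 4 * (D * (N / u))); last first.
    by field; rewrite gt_eqF.
  by rewrite ler_pM2l.
- move=> w nB b; apply: (le_trans (gram_deviation b (Bdev w nB))).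
  rewrite lerD2l ler_wpM2r ?sqr_ge0// le_eqVlt; apply/orP; left; apply/eqP.
  rewrite /y xE /Adev -/s2.
  have sN : Num.sqrt N ^+ 2 = N by rewrite sqr_sqrtr// ltW.
  have sN0 : Num.sqrt N != 0 by rewrite gt_eqF// sqrtr_gt0.
  rewrite -/N -[X in _ / X]sN; move: (Num.sqrt N) sN0 (Num.sqrt (2 * D)) => a a0 g.
  by field; rewrite a0 gt_eqF.
Qed.

End gram.

(** * Margin of the risk *)

Section margin.
Context d (T : measurableType d) {R : realType} (P : probability T R).
Variables (n p : nat) (Z : 'I_n.+1 -> {RV P >-> (R * p.-tuple R)%type}).
Local Notation integ f := (P.-integrable [set: T] (EFin \o f)).
Local Notation E := (Rintegral P [set: T]).

Lemma xbD i w (b b' : 'cV[R]_p) : xb Z i w (b + b') = xb Z i w b + xb Z i w b'.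
Proof. by rewrite /xb mulmxDr mxE. Qed.

Lemma xbZ i w t (b : 'cV[R]_p) : xb Z i w (t *: b) = t * xb Z i w b.
Proof. by rewrite /xb -scalemxAr mxE. Qed.

Lemma xbB i w (b b' : 'cV[R]_p) : xb Z i w (b - b') = xb Z i w b - xb Z i w b'.
Proof. by rewrite xbD -scaleN1r xbZ mulN1r. Qed.

(* A one-sparse vector already matches any value of the linear index. *)
Lemma sparse_center i w (b : 'cV[R]_p) :
  exists2 b0 : 'cV[R]_p, (l0norm b0 <= 1)%N & xb Z i w (b - b0) = 0.
Proof.
have [/forallP X0|] := boolP [forall j, design Z w i j == 0].
  exists 0.
    by rewrite /l0norm eq_card0// => j; apply/negP => /set_mem/=; rewrite mxE eqxx.
  by rewrite /xb mxE big1// => j _; rewrite (eqP (X0 j)) mul0r.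
move=> /forallPn[j Xj].
pose c := xb Z i w b / design Z w i j.
exists (c *: delta_mx j 0).
  apply: (@leq_trans #|pred1 j|); last by rewrite card1.
  apply: subset_leq_card; apply/fintype.subsetP => l.
  move=> /set_mem/=; rewrite !mxE unfold_in/=; apply: contraNT => /negPf ->.
  by rewrite mulr0.
rewrite xbB xbZ {2}/xb -colE mxE /c divfK ?subrr//.
Qed.

Variables (Y : set R) (rho : R -> R -> R) (B : set 'cV[R]_p) (beta0 : 'cV[R]_p) (m : R).
Hypothesis y_in : forall w, Y (yobs Z ord0 w).
Hypothesis rho_diff : forall y t : R, Y y -> derivable (rho y) t 1.
Hypothesis rho_diff2 : forall y t : R, Y y -> derivable (derive1 (rho y)) t 1.
Hypothesis B_convex : convex_set B.
Hypothesis rho_int : forall b, B b ->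
  P.-integrable setT (fun w => (rho (yobs Z ord0 w) (xb Z ord0 w b))%:E).
Hypothesis beta0_in : B beta0.
Hypothesis argmin : forall b, B b -> risk rho Z ord0 beta0 <= risk rho Z ord0 b.
Hypothesis m_ge0 : 0 <= m.
Hypothesis curved : {ae P, forall w, forall b, B b ->
  m <= derive1n 2 (rho (yobs Z ord0 w)) (xb Z ord0 w b)}.

Lemma risk_margin b : B b -> integ (fun w => xb Z ord0 w (b - beta0) ^+ 2) ->
  m / 2 * E (fun w => xb Z ord0 w (b - beta0) ^+ 2) <=
    risk rho Z ord0 b - risk rho Z ord0 beta0.
Proof.
move=> Bb iq.
pose phi t w := rho (yobs Z ord0 w) (t * xb Z ord0 w b + (1 - t) * xb Z ord0 w beta0).
have Bseg t : 0 <= t <= 1 -> B (t *: b + (1 - t) *: beta0).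
  move=> /andP[t0 t1].
  exact: (set_mem (B_convex (Itv01 t0 t1) (mem_set Bb) (mem_set beta0_in))).
have phiE t w : phi t w = rho (yobs Z ord0 w) (xb Z ord0 w (t *: b + (1 - t) *: beta0)).
  by rewrite /phi xbD !xbZ.
have riskE t b' : b' = t *: b + (1 - t) *: beta0 -> E (phi t) = risk rho Z ord0 b'.
  move=> ->; rewrite /risk unlock; congr fine.
  by apply: eq_integral => w _; rewrite phiE.
rewrite -(riskE 1 b) ?subrr ?scale0r ?addr0 ?scale1r//.
rewrite -(riskE 0 beta0) ?subr0 ?scale0r ?add0r ?scale1r//.
apply: mean_strong_convex => //.
- by rewrite divr_ge0.
- by move=> t t01; apply: eq_integrable (rho_int (Bseg t t01)) => // w _; rewrite /= phiE.
- by move=> w; exact: sqr_ge0.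
- move=> t t01; rewrite (riskE 0 beta0) ?subr0 ?scale0r ?add0r ?scale1r//.
  by rewrite (riskE t _ erefl); apply: argmin; exact: Bseg.
(* The null set excluded by [curved] does not depend on [b], so a single [w] has the curvature bound
   along the whole segment. *)
- move=> t t01; apply: filterS curved => w cw.
  rewrite xbB {1}/phi (le_trans (strongly_convex_segment (m := m) _ _ t01 _))//.
  + by move=> u; exact: rho_diff.
  + by move=> u; exact: rho_diff2.
  + by move=> s s01; have := cw _ (Bseg s s01); rewrite xbD !xbZ.
  + by rewrite /phi !mul1r subrr mul0r addr0 mul0r add0r subr0 mul1r.
Qed.

End margin.

(** * Limits of the probability bound and the size of [t1] *)

Section asymptotics.
Context {R : realType} (p : nat -> nat).
Hypothesis p_infty : p @ \oo --> \oo.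

Lemma cvg_inv_ln : (ln (p k)%:R)^-1 @[k --> \oo] --> (0 : R).
Proof.
have large (A : R) : \forall k \near \oo, A <= ln (p k)%:R.
  have /cvgnyPge/(_ (Num.truncn (expR A)).+1) := p_infty.
  apply: filterS => k pk.
  have pA : expR A <= (p k)%:R.
    by rewrite (le_trans (ltW (truncnS_gt _)))// ler_nat.
  by rewrite -ler_expR lnK// posrE (lt_le_trans (expR_gt0 A)).
apply/gtr0_cvgV0; last exact/cvgryPge.
by apply: filterS (large 1) => k; exact: lt_le_trans.
Qed.

Lemma cvg_inv_nat : ((p k)%:R)^-1 @[k --> \oo] --> (0 : R).
Proof.
have large (A : R) : \forall k \near \oo, A <= (p k)%:R.
  have /cvgnyPge/(_ (Num.truncn A).+1) := p_infty.
  apply: filterS => k pk.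
  by rewrite (le_trans (ltW (truncnS_gt _)))// ler_nat.
apply/gtr0_cvgV0; last exact/cvgryPge.
by apply: filterS (large 1) => k; exact: lt_le_trans.
Qed.

Lemma cvg_probability_bound (C : R) :
  1 - 1 / (p k)%:R `^ (2 * 1) - C / (4 * ln (p k)%:R ^+ 2) @[k --> \oo] --> (1 : R).
Proof.
have -> : (fun k => 1 - 1 / (p k)%:R `^ (2 * 1) - C / (4 * ln (p k)%:R ^+ 2)) =
    (fun k => 1 - ((p k)%:R)^-1 ^+ 2 - C / 4 * (ln (p k)%:R)^-1 ^+ 2 : R).
  apply/funext => k; rewrite mulr1 powR_mulrn// div1r !exprVn.
  by rewrite [(4 * _)^-1]invfM [C * _]mulrA.
rewrite -[X in _ --> X](subr0 (1 : R)) -[X in _ --> X - _](subr0 (1 : R)).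
apply: cvgB.
  apply: cvgB; first exact: cvg_cst.
  rewrite -[X in _ --> X](mulr0 0); under eq_fun do rewrite expr2.
  by apply: cvgM; exact: cvg_inv_nat.
rewrite -[X in _ --> X](mulr0 (C / 4)); apply: cvgM; first exact: cvg_cst.
rewrite -[X in _ --> X](mulr0 0); under eq_fun do rewrite expr2.
by apply: cvgM; exact: cvg_inv_ln.
Qed.

End asymptotics.

Lemma ln_sqr {R : realType} (n : nat) : ln (n%:R ^+ 2) = 2 * ln n%:R :> R.
Proof.
(* At [n = 0] both sides vanish because [ln 0] is 0 by convention. *)
have [->|n0] := posnP n; first by rewrite expr0n !ln0// mulr0.
by rewrite expr2 lnM ?posrE ?ltr0n//; lra.
Qed.

(** A big-O bound holds only eventually; adding the finitely many earlier absolute values makes it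
    hold for every [k]. *)
Lemma bigO1_bounded {R : realType} (u : nat -> R) :
  u =O_\oo (fun=> 1 : R) -> exists2 D : R, 0 < D & forall k, u k <= D.
Proof.
move=> /eqO_exP[D0 D0pos [N _ uD]].
exists (D0 + \sum_(k < N) `|u k|); first by rewrite ltr_pwDl// sumr_ge0.
move=> k; have [kN|Nk] := ltnP k N.
  rewrite (bigD1 (Ordinal kN))//= addrCA (le_trans (ler_norm _))// lerDl.
  by rewrite addr_ge0 ?sumr_ge0// ltW.
rewrite (le_trans (ler_norm _))// (le_trans (uD k Nk))// normr1 mulr1.
by rewrite lerDl sumr_ge0.
Qed.

Lemma ln_nat_ge0 {R : realType} (n : nat) : 0 <= ln n%:R :> R.
Proof. by case: n => [|n]; [rewrite ln0|rewrite ln_ge0// ler1n]. Qed.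

(** Displays [t1] as a multiple of [v]: in the last term the parenthesised factor is the quantity
    that (A2)(i) bounds. *)
Lemma t1E d (T : measurableType d) {R : realType} (P : probability T R) (n p : nat)
    (Z : 'I_n.+1 -> {RV P >-> (R * p.-tuple R)%type}) (K C : R) :
  let v := Num.sqrt (ln p%:R) / Num.sqrt n.+1%:R in
  t1 Z K C = (2 * K * C + 1) * Num.sqrt 2 * v +
    4 * K * (Num.sqrt (second_moment P (M1 Z)) * v) * v.
Proof.
move=> v; rewrite /t1 ln_sqr sqrtrM// /v.
have un : ln p%:R / n.+1%:R =
    (Num.sqrt (ln p%:R) / Num.sqrt n.+1%:R) * (Num.sqrt (ln p%:R) / Num.sqrt n.+1%:R) :> R.
  by rewrite mulrACA -invfM -!expr2 !sqr_sqrtr// ln_nat_ge0.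
have -> : Num.sqrt (second_moment P (M1 Z)) * (2 * ln p%:R) / n.+1%:R =
    2 * Num.sqrt (second_moment P (M1 Z)) * (ln p%:R / n.+1%:R) by ring.
rewrite un; ring.
Qed.

(* Sequences are indexed by k; the k-th model has sample size n = k.+1, so that
   there is always a first observation [ord0]. *)
Theorem lemmaA2 (R : realType)
  (Y : set R) (rho : R -> R -> R)
  (p : nat -> nat)
  (d : nat -> measure_display) (T : forall k, measurableType (d k))
  (P : forall k, probability (T k) R)
  (Z : forall k, 'I_k.+1 -> {RV (P k) >-> (R * (p k).-tuple R)%type})
  (B : forall k, set 'cV[R]_(p k)) (beta0 : forall k, 'cV[R]_(p k))
  (A : forall k, set 'cV[R]_(p k))
  (S0 : forall k, {set 'I_(p k)})
  (OmSc : forall k, 'cV[R]_#|~: S0 k| -> R)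
  (M : nat -> R) (Blocal : forall k, set 'cV[R]_(p k))
  (rx Cx cG CG Crho kappa : R)
  (Om := fun k => cone_norm (A k))
  (uOm := fun k => under_norm (Om k) (@OmSc k))
  (Rk := fun k (b : 'cV[R]_(p k)) => risk rho (Z k) ord0 b)
  (* dimension *)
  (p_infty : p @ \oo --> \oo)
  (* model *)
  (y_in : forall k i w, Y (yobs (Z k) i w))
  (rho_diff : forall y t : R, Y y -> derivable (rho y) t 1)
  (rho_diff2 : forall y t : R, Y y -> derivable (derive1 (rho y)) t 1)
  (B_convex : forall k, convex_set (B k))
  (rho_convex : forall k i w,
     convex_function (B k) (fun b => rho (yobs (Z k) i w) (xb (Z k) i w b)))
  (rho_int : forall k b, B k b ->
     (P k).-integrable setT
       (fun w => (rho (yobs (Z k) ord0 w) (xb (Z k) ord0 w b))%:E))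
  (beta0_in : forall k, B k (beta0 k))
  (beta0_argmin : forall k b, B k b -> Rk k (beta0 k) <= Rk k b)
  (* norms *)
  (A_cone : forall k, positive_convex_cone (A k))
  (S0_allowed : forall k, allowed (Om k) (S0 k))
  (OmSc_largest : forall k, largest_complement_norm (Om k) (@OmSc k))
  (l1_le : forall k b, l1norm b <= uOm k b)
  (dual_le : forall k b, dual_norm (uOm k) b <= linfnorm b)
  (* active set *)
  (S0_active : forall k j, beta0 k j 0 != 0 -> j \in S0 k)
  (* local set *)
  (M_gt0 : forall k, 0 < M k)
  (Blocal_convex : forall k, convex_set (Blocal k))
  (Blocal_sub : forall k,
     Blocal k `<=` [set b | B k b /\ uOm k (b - beta0 k) <= M k])
  (* (A1) *)
  (Z_iid : forall k, iid (Z k))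
  (rx_ge4 : 4 <= rx)
  (X_moment : forall k j,
     ('E_(P k)[fun w => (`|design (Z k) w ord0 j| `^ rx)%R] <= Cx%:E)%E)
  (cG_gt0 : 0 < cG)
  (Gamma_ge : forall k, cG <= Gamma2 (Z k) (Om k) (@OmSc k) 2)
  (Gamma_le : forall k, Gamma2 (Z k) (Om k) (@OmSc k) 2 <= CG)
  (* (A2)(i) *)
  (M_bounded :
     (fun k => Num.max
        (Num.sqrt (second_moment (P k) (M1 (Z k)))
           * Num.sqrt (ln (p k)%:R) / Num.sqrt k.+1%:R)
        (Num.sqrt (second_moment (P k) (M2 (Z k)))
           * Num.sqrt (ln (p k)%:R) / Num.sqrt k.+1%:R))
     =O_\oo (fun=> 1 : R))
  (* (A3): the curvature bound holds uniformly over centres b0 in the l0-ball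
     of radius s0 = #|S0|, within kappa of the linear index of b0.  The set of
     b with sup_b0 |X_i'(b - b0)| <= kappa is empty when X_i <> 0 and s0 > 0
     (the ball is unbounded), so the supremum is not read as a restriction
     on b. *)
  (Crho_gt0 : 0 < Crho) (kappa_gt0 : 0 < kappa)
  (rho_curved : forall k i,
     {ae P k, forall w, forall b0 b : 'cV[R]_(p k),
        (l0norm b0 <= #|S0 k|)%N -> B k b ->
        `|xb (Z k) i w (b - b0)| <= kappa ->
        1 / Crho ^+ 2 <= derive1n 2 (rho (yobs (Z k) i w)) (xb (Z k) i w b)}) :
  exists K Ct c C : R,
    [/\ [/\ 0 < K, 0 < Ct, 0 < c & 0 < C],
        (* t1 is positive and of order sqrt (ln p / n) *)
        (forall k, (1 < p k)%N -> 0 < t1 (Z k) K Ct),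
        (fun k => t1 (Z k) K Ct)
          =O_\oo (fun k => Num.sqrt (ln (p k)%:R / k.+1%:R)),
        (* the probability bound tends to 1 *)
        (fun k => 1 - 1 / (p k)%:R `^ (2 * c) - C / (4 * ln (p k)%:R ^+ 2))
          @ \oo --> (1 : R)
      & (* the margin inequality on an event of at least that probability *)
        forall k, (1 < p k)%N ->
        exists E : set (T k),
          [/\ measurable E,
              ((1 - 1 / (p k)%:R `^ (2 * c) - C / (4 * ln (p k)%:R ^+ 2))%:E
                 <= P k E)%E
            & forall w, E w -> forall b, Blocal k b ->
                empnorm2 (design (Z k) w *m (b - beta0 k)) / (2 * Crho ^+ 2)
                  - M k ^+ 2 * t1 (Z k) K Ct / (2 * Crho ^+ 2)
                <= Rk k b - Rk k (beta0 k)]].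
Proof.
have [D0 D0_gt0 MD0] := bigO1_bounded M_bounded.
have MD k : second_moment (P k) (M1 (Z k)) * ln (p k)%:R / k.+1%:R <= D0 ^+ 2.
  have m0 : 0 <= second_moment (P k) (M1 (Z k)).
    rewrite /second_moment unlock fine_ge0//; apply: integral_ge0 => w _.
    by rewrite lee_fin sqr_ge0.
  have u0 : 0 <= ln (p k)%:R :> R.
    exact: ln_nat_ge0.
  have n0 : (0 : R) <= k.+1%:R by [].
  have := MD0 k; rewrite ge_max => /andP[h _].
  have {h} : Num.sqrt (second_moment (P k) (M1 (Z k)) * ln (p k)%:R / k.+1%:R) <= D0.
    by rewrite !sqrtrM ?mulr_ge0// sqrtrV.
  rewrite -ler_sqr ?nnegrE ?sqrtr_ge0 ?(ltW D0_gt0)//.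
  by rewrite sqr_sqrtr// divr_ge0// mulr_ge0.
pose D := D0 ^+ 2.
have D_gt0 : 0 < D by rewrite exprn_gt0.
(* This is [Adev] of [gram_concentration], so the entrywise deviation there is [Ct * v k], with [v]
   as below. *)
pose Ct := 2 * Num.sqrt (2 * D) * ((1 + `|Cx|) / (2 * D) + 7) + 1.
have Ct_gt0 : 0 < Ct.
  rewrite ltr_wpDl// mulr_ge0 ?mulr_ge0 ?sqrtr_ge0//.
  have s0 : 0 <= 1 + `|Cx| by rewrite addr_ge0.
  by rewrite addr_ge0// divr_ge0// mulr_ge0// ltW.
have S0_gt0 k : (0 < #|S0 k|)%N.
  rewrite lt0n; apply/negP => /eqP c0; have := Gamma_ge k.
  by rewrite Gamma2_card0// leNgt cG_gt0.
pose v k : R := Num.sqrt (ln (p k)%:R) / Num.sqrt k.+1%:R.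
have v_ge0 k : 0 <= v k by rewrite divr_ge0 ?sqrtr_ge0.
have sM k : Num.sqrt (second_moment (P k) (M1 (Z k))) * v k <= D0.
  by have := MD0 k; rewrite ge_max mulrA => /andP[].
have sM_ge0 k : 0 <= Num.sqrt (second_moment (P k) (M1 (Z k))) * v k.
  by rewrite mulr_ge0 ?sqrtr_ge0.
have sqrt2_ge1 : 1 <= Num.sqrt 2 :> R.
  by rewrite -[leLHS]sqrtr1 ler_sqrt// ler1n.
(* The first bound absorbs the Gram deviation into [t1], the second gives positivity; both follow by
   discarding the nonnegative [M1] term. *)
have t1_ge k : Ct * v k <= t1 (Z k) 1 Ct /\ v k <= t1 (Z k) 1 Ct.
  have rest : 0 <= 4 * 1 * (Num.sqrt (second_moment (P k) (M1 (Z k))) * v k) * v k.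
    by rewrite mulr_ge0 ?mulr_ge0.
  have main : (2 * Ct + 1) * v k <= (2 * 1 * Ct + 1) * Num.sqrt 2 * v k.
    by rewrite mulr1 ler_wpM2r// ler_peMr//; lra.
  have Cv : 0 <= Ct * v k by rewrite mulr_ge0// ltW.
  by rewrite t1E -/(v k); split; move: (v_ge0 k); lra.
have t1_le k : t1 (Z k) 1 Ct <= ((2 * Ct + 1) * Num.sqrt 2 + 4 * D0) * v k.
  rewrite t1E -/(v k) !mulr1 [leRHS]mulrDl lerD2l.
  by rewrite ler_wpM2r// ler_pM2l.
(* [c = 1] and [C = 16 * D] are read off the probability in [gram_concentration]. *)
exists 1, Ct, 1, (16 * D); split.
- by split => //; rewrite mulr_gt0.
- move=> k pk; case: (t1_ge k) => _; apply: lt_le_trans.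
  by rewrite divr_gt0// sqrtr_gt0// ln_gt0// ltr1n.
- apply/eqO_exP; exists ((2 * Ct + 1) * Num.sqrt 2 + 4 * D0).
    by rewrite ltr_wpDl ?mulr_gt0// mulr_ge0 ?sqrtr_ge0//; lra.
  apply: filterE => k; case: (t1_ge k) => _ vt.
  rewrite ger0_norm; last exact: le_trans vt.
  by rewrite ger0_norm ?sqrtr_ge0// sqrtrM ?ln_nat_ge0// sqrtrV//; exact: t1_le.
- exact: cvg_probability_bound.
move=> k pk.
have [Bset [mB PB HB]] := gram_concentration (Z_iid k) rx_ge4 (X_moment k) pk D_gt0 (MD k).
exists Bset; split => // w Bw b Blb.
have [Bb uOmb] := Blocal_sub k b Blb.
have m_ge0 : 0 <= 1 / Crho ^+ 2 by rewrite divr_ge0 ?sqr_ge0.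
have curved : {ae P k, forall w, forall b, B k b ->
    1 / Crho ^+ 2 <= derive1n 2 (rho (yobs (Z k) ord0 w)) (xb (Z k) ord0 w b)}.
  apply: filterS (rho_curved k ord0) => w' cw b' Bb'.
  (* This centre lies in the l0-ball since [S0 k] is nonempty, and the index of [b' - b0] is 0,
     within [kappa]. *)
  have [b0 b01 xb0] := sparse_center (Z k) ord0 w' b'.
  by apply: (cw b0) => //; [exact: leq_trans (S0_gt0 k)|rewrite xb0 normr0 ltW].
have iq := integ_xb2 rx_ge4 (X_moment k) (b - beta0 k).
have := risk_margin (y_in k ord0) rho_diff rho_diff2 (@B_convex k) (@rho_int k)
  (beta0_in k) (@beta0_argmin k) m_ge0 curved Bb iq.
have := HB w Bw (b - beta0 k).
set q := Rintegral _ _ _ => emp_le risk_ge.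
apply: le_trans risk_ge.
have l1_ge0 : 0 <= l1norm (b - beta0 k) by rewrite sumr_ge0.
have l1M : l1norm (b - beta0 k) ^+ 2 <= M k ^+ 2.
  by rewrite lerXn2r ?nnegrE ?(ltW (M_gt0 k))// (le_trans (l1_le _ _)).
have [t_ge _] := t1_ge k.
have vE : Ct * Num.sqrt (ln (p k)%:R) / Num.sqrt k.+1%:R = Ct * v k by rewrite mulrA.
have : empnorm2 (design (Z k) w *m (b - beta0 k)) - M k ^+ 2 * t1 (Z k) 1 Ct <= q.
  rewrite lerBlDr (le_trans emp_le)// lerD2l -/Ct vE mulrC.
  by apply: ler_pM => //; rewrite ?sqr_ge0 ?mulr_ge0// ltW.
rewrite -mulrBl => h.
rewrite (_ : 1 / Crho ^+ 2 / 2 * q = q / (2 * Crho ^+ 2)); last first.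
  by field; rewrite gt_eqF.
by rewrite ler_pM2r// invr_gt0 mulr_gt0// exprn_gt0.
Qed.
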